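(* The three-color Ramsey number of the path $P_8$ satisfies $R_3(P_8) = 14$.
   Context: All graphs are undirected, finite, with no loops or multiple edges. $P_k$ denotes the path on $k$ vertices, and $K_N$ denotes the complete graph on $N$ vertices. For a graph $G$, the three-color diagonal Ramsey number $R_3(G) = R(G,G,G)$ is the smallest integer $N$ such that every coloring of the edges of $K_N$ with 3 colors contains a monochromatic copy of $G$ (as a not necessarily induced subgraph), i.e. there is a color $i \in \{1,2,3\}$ such that the graph formed by the edges of color $i$ contains a subgraph isomorphic to $G$. *)

(* Defs.v *)
From mathcomp Require Import all_boot.

Set Implicit Arguments.
Unset Strict Implicit.
Unset Printing Implicit Defensive.

Record sgraph := SGraph {
  vertex :> finType;
  adj : rel vertex;
  adj_sym : symmetric adj;
  adj_irrefl : irreflexive adj }.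

Fact complete_sym N : symmetric (fun x y : 'I_N => x != y).
Proof. by move=> x y; rewrite eq_sym. Qed.

Fact complete_irrefl N : irreflexive (fun x y : 'I_N => x != y).
Proof. by move=> x; rewrite eqxx. Qed.

Definition complete_graph (N : nat) : sgraph :=
  SGraph (@complete_sym N) (@complete_irrefl N).

Definition path_adj (k : nat) (x y : 'I_k) : bool :=
  (x.+1 == y :> nat) || (y.+1 == x :> nat).

Fact path_adj_sym k : symmetric (@path_adj k).
Proof. by move=> x y; rewrite /path_adj orbC. Qed.

Fact path_adj_irrefl k : irreflexive (@path_adj k).
Proof. by move=> x; rewrite /path_adj orbb; apply/negbTE; rewrite neq_ltn ltnSn orbT. Qed.

(* k counts vertices, not edges. *)
Definition path_graph (k : nat) : sgraph :=
  SGraph (@path_adj_sym k) (@path_adj_irrefl k).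

(* The copy of H in G need not be induced. *)
Definition contains_copy (G H : sgraph) : Prop :=
  exists2 f : H -> G, injective f & forall x y, adj x y -> adj (f x) (f y).

(* An edge is the two-element set of its endpoints.  A colouring is given as a
   function on all vertex sets; only its values on edges are ever used. *)
Definition edge_coloring (G : sgraph) (k : nat) := {set G} -> 'I_k.

Definition color_adj (G : sgraph) k (c : edge_coloring G k) (i : 'I_k)
    (x y : G) : bool :=
  adj x y && (c [set x; y] == i).

Fact color_adj_sym (G : sgraph) k (c : edge_coloring G k) i :
  symmetric (color_adj c i).
Proof. by move=> x y; rewrite /color_adj adj_sym setUC. Qed.

Fact color_adj_irrefl (G : sgraph) k (c : edge_coloring G k) i :
  irreflexive (color_adj c i).
Proof. by move=> x; rewrite /color_adj adj_irrefl. Qed.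

Definition color_class (G : sgraph) k (c : edge_coloring G k) (i : 'I_k) :
    sgraph :=
  SGraph (color_adj_sym c i) (color_adj_irrefl c i).

Definition ramsey_property (k : nat) (G : sgraph) (N : nat) : Prop :=
  forall c : edge_coloring (complete_graph N) k,
    exists i : 'I_k, contains_copy (color_class c i) G.

(* "R_k(G) = N", as a relation; it determines N by the next lemma. *)
Definition is_ramsey_number (k : nat) (G : sgraph) (N : nat) : Prop :=
  ramsey_property k G N /\ (forall M, ramsey_property k G M -> N <= M).

Lemma is_ramsey_number_uniq k G N N' :
  is_ramsey_number k G N -> is_ramsey_number k G N' -> N = N'.
Proof.
by move=> [hN mN] [hN' mN']; apply/eqP; rewrite eqn_leq mN // mN'.
Qed.

(* Main.v *)
(* A graph on n vertices with no path on 8 vertices and no 6-cycle has at most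
   2n edges, so some colour, say red, with more than 30 of the 91 edges of K_14
   contains a 6-cycle, or hexagon.  A vertex attached to it from outside has no
   red neighbour off the hexagon, so if at most two vertices are attached the
   vertex set splits 6 + 8 or 7 + 7 with no red edge across; the bipartite
   edge bound gives an alternating hexagon in another colour, and a finite
   case tree then finds a monochromatic path.  Otherwise the positions where
   vertices are attached are pairwise nonconsecutive, and counting red edges
   forces three of them, the hubs: off the hubs, all red edges lie inside a
   set W of at most 5 vertices.  The 11 vertices other than the hubs again
   contain a hexagon in a second colour, and what is known about the first two
   colours leaves a path in the third one. *)

(* Edges are counted through degree sums, so every threshold is doubled: 2n edges become [4 * n],
   and the 182 = 14 * 13 ordered pairs leave one colour above 60. A hexagon would need only more
   than 56 = 4 * 14; the surplus pays for the count around it, where at most two attachment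
   positions keep the degree sum within 60. Both density bounds come from longest paths: the
   neighbours of an end lie on the path, which has at most 7 vertices, so the possibilities at the
   ends form a finite problem. Finite problems are solved on patterns with labels in [nat]:
   [vm_compute] finds a path or cycle using only pairs known to be edges, and a labelling carries it
   into the graph. In the 6 + 8 and 7 + 7 splits a pair between the sides still has two possible
   colours, so a search in one fixed pattern does not apply and explicit case trees branch on the
   colours. With hubs in one colour and a hexagon in another, enough pairs avoid both colours, and a
   plain search works again. *)
Require Import Defs.
From mathcomp Require Import all_boot zify.

Set Implicit Arguments.
Unset Strict Implicit.
Unset Printing Implicit Defensive.

(** * Searching for paths and cycles in a pattern *)

(* Unlike [has], this stops at the first hit under call-by-value evaluation,
   where [||] evaluates both of its arguments. *)
Fixpoint any (p : nat -> bool) (s : seq nat) : bool :=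
  if s is x :: s' then if p x then true else any p s' else false.

Lemma anyE p s : any p s = has p s.
Proof. by elim: s => //= x s ->; case: (p x). Qed.

(** Depth-first search with visited labels [vis]. The test [stop] on the last label is trivial for
    paths and asks for the closing edge for cycles, so one search serves both. *)
Fixpoint walk (nbrs : seq (seq nat)) (stop : pred nat) d vis x : bool :=
  if d is d'.+1 then
    any (fun y => if y \in vis then false else walk nbrs stop d' (y :: vis) y)
        (nth [::] nbrs x)
  else stop x.

Definition neighbours (n : nat) (k : rel nat) : seq (seq nat) :=
  [seq [seq j <- iota 0 n | k i j] | i <- iota 0 n].

Definition has_path (L n : nat) (k : rel nat) : bool :=
  let nbrs := neighbours n k in
  any (fun x => walk nbrs predT L.-1 [:: x] x) (iota 0 n).

Definition has_cycle (L n : nat) (k : rel nat) : bool :=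
  let nbrs := neighbours n k in
  any (fun x => walk nbrs (fun y => x \in nth [::] nbrs y) L.-1 [:: x] x)
    (iota 0 n).

Lemma mem_neighbours n k i j :
  (j \in nth [::] (neighbours n k) i) = [&& i < n, j < n & k i j].
Proof.
rewrite /neighbours; have [lt_in | le_ni] := ltnP i n.
  rewrite (nth_map 0) ?size_iota // nth_iota // add0n mem_filter mem_iota.
  by rewrite leq0n add0n andbC.
by rewrite nth_default // size_map size_iota.
Qed.

Lemma walkP n k stop d vis x :
  walk (neighbours n k) stop d vis x ->
  exists q, [/\ size q = d, path k x q, uniq q,
    {in q, forall y, (y < n) && (y \notin vis)} & stop (last x q)].
Proof.
elim: d vis x => [|d IHd] vis x /= => [stop_x|]; first by exists [::].
rewrite anyE => /hasP[y]; rewrite mem_neighbours => /and3P[_ lt_yn kxy].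
case: ifP => // /negbT vis'y /IHd[q [sz_q q_path q_uniq q_vis stop_q]].
exists (y :: q); split=> //=; first by rewrite sz_q.
- by rewrite kxy.
- rewrite q_uniq andbT; apply/negP=> /q_vis.
  by rewrite mem_head andbF.
- move=> z; rewrite inE => /predU1P[-> | /q_vis]; first by rewrite lt_yn.
  by rewrite inE negb_or => /and3P[-> _ ->].
Qed.

Section Patterns.

Variables (T : eqType) (e : rel T) (x0 : T) (s : seq T) (k : rel nat).
Hypothesis s_uniq : uniq s.
Hypothesis ks : forall i j,
  i < size s -> j < size s -> k i j -> e (nth x0 s i) (nth x0 s j).

Let path_pattern i q : i < size s -> {in q, forall j, j < size s} ->
  path k i q -> path e (nth x0 s i) (map (nth x0 s) q).
Proof.
elim: q i => //= j q IHq i lt_i lt_q /andP[kij q_path].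
have lt_j: j < size s by apply: lt_q; rewrite mem_head.
rewrite ks // IHq // => l ql; apply: lt_q.
by rewrite inE ql orbT.
Qed.

Let uniq_pattern q :
  {in q, forall j, j < size s} -> uniq (map (nth x0 s) q) = uniq q.
Proof.
move=> lt_q; rewrite map_inj_in_uniq // => i j qi qj.
by move/eqP; rewrite nth_uniq ?lt_q // => /eqP.
Qed.

(** The pattern [k] need only be a lower bound for the edges among [s], so a path found by
    computation survives in every graph that realises it. *)
Lemma has_pathP L : 0 < L -> has_path L (size s) k ->
  exists q, [/\ size q = L, uniq q, sorted e q & {subset q <= s}].
Proof.
case: L => // L _; rewrite /has_path anyE => /hasP[i].
rewrite mem_iota => /= lt_i /walkP[q [sz_q q_path q_uniq q_lt _]].
have lt_iq: {in i :: q, forall j, j < size s}.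
  by move=> j; rewrite inE => /predU1P[-> | /q_lt/andP[]].
exists (map (nth x0 s) (i :: q)); split.
- by rewrite size_map /= sz_q.
- rewrite uniq_pattern //= q_uniq andbT; apply/negP=> /q_lt.
  by rewrite mem_head andbF.
- by apply: path_pattern => // j qj; apply: lt_iq; rewrite inE qj orbT.
- by move=> _ /mapP[j /lt_iq lt_j ->]; apply: mem_nth.
Qed.

Lemma has_cycleP L : 0 < L -> has_cycle L (size s) k ->
  exists q, [/\ size q = L, uniq q, cycle e q & {subset q <= s}].
Proof.
case: L => // L _; rewrite /has_cycle anyE => /hasP[i].
rewrite mem_iota => /= lt_i /walkP[q [sz_q q_path q_uniq q_lt]].
rewrite mem_neighbours => /and3P[lt_l _ kl].
have lt_q: {in q, forall j, j < size s} by move=> j /q_lt/andP[].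
have lt_iq: {in i :: q, forall j, j < size s}.
  by move=> j; rewrite inE => /predU1P[-> | /lt_q].
exists (map (nth x0 s) (i :: q)); split.
- by rewrite size_map /= sz_q.
- rewrite uniq_pattern //= q_uniq andbT; apply/negP=> /q_lt.
  by rewrite mem_head andbF.
- by rewrite /= rcons_path last_map path_pattern //= ks.
- by move=> _ /mapP[j /lt_iq lt_j ->]; apply: mem_nth.
Qed.

End Patterns.

(** * Graphs without hexagons *)

Fixpoint all_bits (n : nat) (P : bitseq -> bool) : bool :=
  if n is n'.+1 then
    if all_bits n' (fun b => P (true :: b)) then
      all_bits n' (fun b => P (false :: b))
    else false
  else P [::].

Lemma all_bitsP n P : all_bits n P -> forall b, size b = n -> P b.
Proof.
elim: n P => [P Pnil [] // | n IHn P /=].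
case: ifP => // Ptrue Pfalse [//|[] b] [sz_b].
  exact: IHn Ptrue b sz_b.
exact: IHn Pfalse b sz_b.
Qed.

Definition path8_free (T : eqType) (e : rel T) : Prop :=
  forall s, size s = 8 -> uniq s -> ~~ sorted e s.

Section Density.

Variables (T : finType) (e : rel T).
Hypotheses (e_sym : symmetric e) (e_irr : irreflexive e).

(** A sum of booleans rather than a cardinal, so that double counting is an exchange of sums. *)
Definition deg (S : {set T}) (x : T) : nat := \sum_(y in S) e x y.
(** For a simple graph, twice the number of edges inside [S]. *)
Definition degsum (S : {set T}) : nat := \sum_(x in S) deg S x.

Lemma degE S x : deg S x = #|[set y in S | e x y]|.
Proof.
rewrite -sum1_card /deg big_mkcond [RHS]big_mkcond.
by apply: eq_bigr => y _; rewrite inE; case: (y \in S); case: (e x y).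
Qed.

Lemma deg_sub (S : {set T}) (s : seq T) x :
  {in S, forall y, e x y -> y \in s} -> deg S x <= size s.
Proof.
move=> sub; rewrite degE; apply: leq_trans (card_size s).
apply/subset_leq_card/subsetP=> y; rewrite inE => /andP[]; exact: sub.
Qed.

Lemma degD (S A : {set T}) x :
  A \subset S -> deg S x = deg A x + deg (S :\: A) x.
Proof.
move=> /setIidPr SA; rewrite /deg (big_setID A) /= SA //.
Qed.

(** An edge inside [A] contributes 2 through [deg S] at its two ends; an edge leaving [A]
    contributes 2 at its single end in [A], once in each of the two degrees. *)
Lemma degsumD (S A : {set T}) : A \subset S ->
  degsum S = degsum (S :\: A) + \sum_(x in A) (deg S x + deg (S :\: A) x).
Proof.
move=> sAS; rewrite {1}/degsum (big_setID A) /= (setIidPr sAS).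
rewrite big_split /= [RHS]addnCA; congr (_ + _).
under eq_bigr do rewrite (degD _ sAS).
rewrite big_split /= [LHS]addnC; congr (_ + _).
rewrite /deg exchange_big /=; apply: eq_bigr => x _.
by apply: eq_bigr => y _; rewrite e_sym.
Qed.

Definition is_path_in (S : {set T}) (p : seq T) : bool :=
  [&& uniq p, sorted e p & all (mem S) p].

Definition longest_in (S : {set T}) (p : seq T) : Prop :=
  is_path_in S p /\ forall q, is_path_in S q -> size q <= size p.

Lemma longest_exists (S : {set T}) : path8_free e -> S != set0 ->
  exists2 p, longest_in S p & 0 < size p <= 7.
Proof.
move=> P8 /set0Pn[x Sx].
pose P n := [exists p : n.-tuple T, is_path_in S p].
have Pin p : is_path_in S p -> P (size p).
  by move=> pP; apply/existsP; exists (in_tuple p).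
have P1 : P 1 by apply: (Pin [:: x]); rewrite /is_path_in /= Sx.
have exP : exists n, P n by exists 1.
have ubP n : P n -> n <= 7.
  move=> /existsP[p /and3P[p_uniq p_path _]]; rewrite leqNgt; apply/negP=> n8.
  have := P8 (take 8 p); rewrite size_takel ?size_tuple // take_uniq //.
  by move/(_ erefl isT); rewrite take_sorted.
case: (ex_maxnP exP ubP) => n /existsP[p pP] max_n.
exists p; last first.
  by rewrite size_tuple ubP ?max_n //; apply/existsP; exists p.
split=> // q /Pin/max_n; by rewrite size_tuple.
Qed.

Lemma rev_path_in S p : is_path_in S (rev p) = is_path_in S p.
Proof.
rewrite /is_path_in rev_uniq all_rev rev_sorted; congr [&& _, _ & _].
by apply: eq_sorted => x y; rewrite e_sym.
Qed.

Lemma longest_rev S p : longest_in S p -> longest_in S (rev p).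
Proof. by move=> [pP p_max]; split; rewrite ?rev_path_in ?size_rev. Qed.

(** A neighbour off the path could be put in front of it, giving a longer path. *)
Lemma longest_head (S : {set T}) x p : longest_in S (x :: p) ->
  {in S, forall y, e x y -> y \in x :: p}.
Proof.
move=> [/and3P[p_uniq p_path p_S] p_max] y Sy exy; apply/negPn/negP=> p'y.
have /p_max: is_path_in S (y :: x :: p); last by rewrite /= ltnn.
rewrite /is_path_in /= in p_uniq p_path p_S *.
by rewrite p'y p_uniq e_sym exy p_path Sy p_S.
Qed.

(* A path on labels 0, ..., k - 1 whose ends 0 and k - 1 are joined to the
   labels marked in a and in b. *)
Definition chorded_path (k : nat) (a b : bitseq) (i j : nat) : bool :=
  [|| i.+1 == j, j.+1 == i,
      (i == 0) && nth false a j, (j == 0) && nth false a i,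
      (i == k.-1) && nth false b j | (j == k.-1) && nth false b i].

(* The exception comes from two copies of K_4 sharing the middle label 3. *)
Lemma chorded_path_cycle k a b : 0 < k <= 7 -> size a = k -> size b = k ->
  ~~ nth false a 0 -> ~~ nth false b k.-1 -> 2 < count id a -> 2 < count id b ->
  [|| has_cycle k k (chorded_path k a b), has_cycle 6 k (chorded_path k a b) |
      (k == 7) && (a == [:: false; true; true; true; false; false; false])].
Proof.
move=> k_range szA szB a0 bk cA cB.
have: all (fun k => all_bits k (fun a =>
    if ~~ nth false a 0 && (2 < count id a) then all_bits k (fun b =>
      if ~~ nth false b k.-1 && (2 < count id b) then
        [|| has_cycle k k (chorded_path k a b),
          has_cycle 6 k (chorded_path k a b) |
          (k == 7) && (a == [:: false; true; true; true; false; false; false])]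
      else true) else true)) (iota 1 7).
  by vm_compute.
move/allP/(_ k); rewrite mem_iota => /(_ k_range)/all_bitsP/(_ a szA).
by rewrite a0 cA => /all_bitsP/(_ b szB); rewrite bk cB.
Qed.


Definition no_cycle_in (S : {set T}) (L : nat) : Prop :=
  forall q, size q = L -> uniq q -> {subset q <= S} -> ~~ cycle e q.

Lemma no_cycleP (S : {set T}) L :
  no_cycle_in S L \/
  exists q, [/\ size q = L, uniq q, {subset q <= S} & cycle e q].
Proof.
have [/existsP[q /and3P[q_uniq q_cyc /allP q_S]] | ] :=
    boolP [exists q : L.-tuple T, [&& uniq q, cycle e q & all (mem S) q]].
  by right; exists q; rewrite size_tuple.
rewrite negb_exists => /forallP nok; left=> q sz_q q_uniq q_S.
apply/negP=> q_cyc; have /negP := nok (tcast sz_q (in_tuple q)); apply.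
by rewrite val_tcast /= q_uniq q_cyc; apply/allP.
Qed.

Lemma deg_longest (S : {set T}) x p :
  longest_in S (x :: p) -> deg S x <= count (e x) (x :: p).
Proof.
move=> p_long; rewrite -size_filter; apply: deg_sub => y Sy exy.
by rewrite mem_filter exy (longest_head p_long).
Qed.

(** Both ends have at least three neighbours, all on the path, so [chorded_path_cycle] applies. With
    a hexagon and a cycle through all of [p] ruled out, only its exceptional case survives. *)
Lemma longest_acyclic (S : {set T}) p : longest_in S p -> 0 < size p <= 7 ->
    {in S, forall x, 2 < deg S x} ->
    no_cycle_in S 6 -> no_cycle_in S (size p) ->
  exists x0 x1 x2 x3 p', [/\ p = [:: x0, x1, x2, x3 & p'], size p' = 3 &
    {in S, forall y, e x0 y = (y \in [:: x1; x2; x3])}].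
Proof.
move=> p_long p_size deg_gt2 no6 nok.
have [/and3P[p_uniq p_path /allP p_S] p_max] := p_long.
case def_p: p p_size => [|x0 p1] //; rewrite -def_p => p_size.
set x := last x0 p1.
have x0_p: x0 = nth x0 p 0 by rewrite def_p.
have x_p: x = nth x0 p (size p).-1 by rewrite def_p nth_last.
have deg0: 2 < count (e x0) p.
  rewrite def_p in p_long p_S *; apply: leq_trans (deg_longest p_long).
  by apply: deg_gt2; apply: p_S; rewrite mem_head.
have degx: 2 < count (e x) p.
  have p_rev: rev p = x :: rev (belast x0 p1).
    by rewrite def_p lastI rev_rcons.
  have /longest_rev := p_long; rewrite p_rev => p_long'.
  rewrite -count_rev p_rev; apply: leq_trans (deg_longest p_long').
  by apply: deg_gt2; apply: p_S; rewrite def_p mem_last.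
pose a := map (e x0) p; pose b := map (e x) p.
have nth_map_e y i : i < size p ->
    nth false [seq e y z | z <- p] i = e y (nth x0 p i).
  by move=> lt_i; rewrite (nth_map x0).
have chP i j : i < size p -> j < size p -> chorded_path (size p) a b i j ->
    e (nth x0 p i) (nth x0 p j).
  have step l : l.+1 < size p -> e (nth x0 p l) (nth x0 p l.+1).
    by move=> lt_l; move/(sortedP x0): p_path; apply.
  move=> lt_i lt_j /or4P[/eqP ij | /eqP ji | /andP[/eqP i0] | /or3P[]].
  - by rewrite -ij step ?ij.
  - by rewrite e_sym -ji step ?ji.
  - by rewrite nth_map_e // i0 -x0_p.
  - by case/andP=> /eqP->; rewrite nth_map_e // -x0_p e_sym.
  - by case/andP=> /eqP->; rewrite nth_map_e // -x_p.
  - by case/andP=> /eqP->; rewrite nth_map_e // -x_p e_sym.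
have no_cyc L : 0 < L -> no_cycle_in S L ->
    has_cycle L (size p) (chorded_path (size p) a b) = false.
  move=> L_gt0 noL; apply/negP => /(has_cycleP p_uniq chP)-/(_ L_gt0).
  case=> q [sz_q q_uniq q_cycle q_p].
  by have /negP := noL q sz_q q_uniq (fun y yq => p_S y (q_p y yq)).
have := @chorded_path_cycle (size p) a b p_size.
rewrite !size_map !count_map !no_cyc //; last by case/andP: p_size.
case/andP: (p_size) => p_gt0 _.
rewrite !nth_map_e ?prednK // -x0_p -x_p !e_irr.
move=> /(_ erefl erefl isT isT deg0 degx)/= /andP[/eqP sz_p /eqP def_a].
have [x1 [x2 [x3 [p' [def_p1 e1 e2 e3 e_p']]]]] : exists x1 x2 x3 p',
    [/\ p1 = [:: x1, x2, x3 & p'], e x0 x1, e x0 x2, e x0 x3 &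
    map (e x0) p' = [:: false; false; false]].
  move: def_a; rewrite /a def_p.
  case: (p1) => [|x1 [|x2 [|x3 p']]] // [_ e1 e2 e3 e_p'].
  by exists x1, x2, x3, p'.
exists x0, x1, x2, x3, p'; rewrite def_p def_p1; split=> //.
  by rewrite -(size_map (e x0)) e_p'.
move=> y Sy; apply/idP/idP=> [e_y|]; last first.
  by rewrite !inE => /or3P[]/eqP->.
rewrite def_p def_p1 in p_long; have := longest_head p_long Sy e_y.
rewrite -[_ :: _]/([:: x0; x1; x2; x3] ++ p') mem_cat => /orP[].
  by rewrite !inE => /predU1P[y_x0|//]; rewrite y_x0 e_irr in e_y.
by move/(map_f (e x0)); rewrite e_p' e_y.
Qed.

(* Summed over A, these degrees count every edge of S that meets A twice. *)
Definition removable (S A : {set T}) : Prop :=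
  [/\ A \subset S, A != set0 &
      {in A, forall x, deg S x + deg (S :\: A) x <= 4}].

(** No edge of [S] leaves the cycle: cutting the cycle at the edge's end and prepending the new
    vertex would beat the longest path. So only degrees inside the cycle count. They are at most 4
    for length at most 5, length 6 is excluded, and for length 7 a chord skipping one vertex would
    close a hexagon, which leaves four possible neighbours. *)
Lemma removable_cycle (S : {set T}) p q : longest_in S p -> 0 < size p <= 7 ->
    no_cycle_in S 6 ->
    size q = size p -> uniq q -> {subset q <= S} -> cycle e q ->
  removable S [set x in q].
Proof.
move=> [_ p_max] p_size no6 sz_q q_uniq q_S q_cyc.
have closed x : x \in q -> {in S, forall y, e x y -> y \in q}.
  move=> qx y Sy exy; apply/negPn/negP=> q'y.
  have [i q' def_q] := rot_to qx.
  have: is_path_in S (y :: x :: q').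
    rewrite /is_path_in -def_q cons_uniq rot_uniq mem_rot q'y q_uniq /=.
    have -> : all (mem S) (rot i q).
      by apply/allP=> z; rewrite mem_rot; apply: q_S.
    move: q_cyc; rewrite -(rot_cycle i) def_q /= rcons_path => /andP[-> _].
    by rewrite e_sym exy Sy.
  by move/p_max; rewrite /= -[_.+1]/((size (x :: q')).+1) -def_q size_rot sz_q
    ltnn.
split.
- by apply/subsetP=> x; rewrite inE => /q_S.
- have: 0 < size q by rewrite sz_q; case/andP: p_size.
  by case: (q) => // x q' _; apply/set0Pn; exists x; rewrite inE mem_head.
move=> x; rewrite inE => qx.
have -> : deg (S :\: [set x in q]) x = 0.
  rewrite /deg big1 // => y; rewrite !inE => /andP[q'y Sy].
  by apply/eqP; rewrite eqb0; apply: contra q'y; apply: closed.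
rewrite addn0.
have [i q' def_q] := rot_to qx.
have mem_q' y : (y \in q) = (y \in x :: q') by rewrite -def_q mem_rot.
have sz_q' : (size q').+1 = size p by rewrite -sz_q -(size_rot i q) def_q.
have uniq_q' : uniq (x :: q') by rewrite -def_q rot_uniq.
have cyc_q' : cycle e (x :: q') by rewrite -def_q rot_cycle.
have sub_q' : {subset x :: q' <= S} by move=> y; rewrite -mem_q'; apply: q_S.
have {}closed y : y \in S -> e x y -> y \in q'.
  move=> Sy exy; have := closed x qx y Sy exy; rewrite mem_q' inE.
  by case/predU1P=> // y_x; rewrite y_x e_irr in exy.
have [le4|] := leqP (size q') 4.
  exact: leq_trans (deg_sub closed) le4.
rewrite -ltnS sz_q'; case/andP: p_size => _; rewrite leq_eqVlt => /predU1P[p7|].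
  move: q' {def_q mem_q' sz_q'} (eq_trans sz_q' p7) uniq_q' cyc_q' sub_q'
    closed.
  move=> [|x1 [|x2 [|x3 [|x4 [|x5 [|x6 [|//]]]]]]] // _ uniq_q' cyc_q' sub_q'.
  move=> closed _.
  have no_mask m : size (mask m [:: x; x1; x2; x3; x4; x5; x6]) = 6 ->
      ~~ cycle e (mask m [:: x; x1; x2; x3; x4; x5; x6]).
    move=> sz_m; apply: no6 => //; first exact: mask_uniq.
    by move=> y /mem_mask; apply: sub_q'.
  have nx2 : ~~ e x x2.
    have := no_mask [:: true; false; true; true; true; true; true] erefl.
    have /= /and5P[_ _ -> -> /and3P[-> -> /andP[-> _]]] /= := cyc_q'.
    by rewrite !andbT.
  have nx5 : ~~ e x x5.
    have := no_mask [:: true; true; true; true; true; true; false] erefl.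
    have /= /and5P[-> -> -> -> /andP[-> _]] /= := cyc_q'.
    by rewrite andbT e_sym.
  apply: (@deg_sub _ [:: x1; x3; x4; x6]) => y Sy exy.
  have := closed y Sy exy; rewrite !inE.
  by case/or4P=> [->|y2|->|/or3P[->|y5|->]]; rewrite ?orbT //;
    [rewrite -(eqP y2) exy in nx2 | rewrite -(eqP y5) exy in nx5].
rewrite ltnS leq_eqVlt => /predU1P[p6|]; last
  by case: (size p) => [|[|[|[|[|[]]]]]].
by have /negP := no6 q (eq_trans sz_q p6) q_uniq q_S.
Qed.

(** A vertex of degree at most 2 costs at most 2 + 2, and a closed longest path is handled by
    [removable_cycle]. Otherwise a longest path starts with a K_4 whose first three vertices have no
    other neighbours; each of them costs 3 inside the K_4 plus 1 for its edge to [x3]. *)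
Lemma removable_exists (S : {set T}) : path8_free e -> no_cycle_in S 6 ->
  S != set0 -> exists A, removable S A.
Proof.
move=> P8 no6 nzS.
have [/existsP[x /andP[Sx deg_x]] | ] := boolP [exists x in S, deg S x <= 2].
  exists [set x]; split; first by rewrite sub1set.
    by apply/set0Pn; exists x; rewrite inE.
  move=> y /set1P->; apply: (@leq_add _ _ 2 2) => //.
  apply: leq_trans deg_x; rewrite (@degD S [set x] x) ?leq_addl //.
  by rewrite sub1set.
rewrite negb_exists => /forallP deg_gt2.
have {}deg_gt2 : {in S, forall x, 2 < deg S x}.
  by move=> x Sx; have := deg_gt2 x; rewrite Sx -ltnNge.
have [p p_long p_size] := longest_exists P8 nzS.
have [nok | [q [sz_q q_uniq q_S q_cyc]]] := no_cycleP S (size p); last first.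
  exists [set x in q].
  exact: removable_cycle p_long p_size no6 sz_q q_uniq q_S q_cyc.
have tri q : longest_in S q -> size q = size p ->
    exists x0 x1 x2 x3 p', [/\ q = [:: x0, x1, x2, x3 & p'], size p' = 3 &
    {in S, forall y, e x0 y = (y \in [:: x1; x2; x3])}].
  move=> q_long sz_q; apply: longest_acyclic => //; rewrite sz_q //.
have [x0 [x1 [x2 [x3 [p' [def_p sz_p' nbr0]]]]]] := tri p p_long erefl.
have [/and3P[p_uniq p_path p_S] p_max] := p_long.
rewrite def_p in p_S p_path p_uniq.
have [S0 S1 S2 S3] : [/\ x0 \in S, x1 \in S, x2 \in S & x3 \in S].
  by case/and5P: p_S.
have swap q : perm_eq q p -> sorted e q -> longest_in S q.
  move=> q_p q_path; split; last by move=> r /p_max; rewrite (perm_size q_p).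
  rewrite /is_path_in (perm_uniq q_p) (perm_all _ q_p) def_p.
  by rewrite p_uniq p_S q_path.
(* The chords from [x0] to [x2] and to [x3] allow the first two, respectively the first three,
   vertices to be reversed. The new paths are again longest, so [tri] also determines the neighbours
   of [x1] and [x2]. *)
have p1_long : longest_in S [:: x1, x0, x2, x3 & p'].
  apply: swap.
    rewrite def_p -/([:: x1; x0] ++ [:: x2, x3 & p']).
    rewrite -/([:: x0; x1] ++ [:: x2, x3 & p']) perm_cat2r.
    exact/permPl/(perm_catC [:: x1] [:: x0]).
  have /= /and4P[e01 _ e23 p_path3] := p_path.
  by rewrite e23 p_path3 e_sym e01 nbr0 // !inE eqxx orbT.
have p2_long : longest_in S [:: x2, x1, x0, x3 & p'].
  apply: swap.
    rewrite def_p -/([:: x2; x1; x0] ++ x3 :: p').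
    rewrite -/([:: x0; x1; x2] ++ x3 :: p') perm_cat2r.
    by rewrite -(perm_rev [:: x2; x1; x0]).
  have /= /and4P[e01 e12 _ p_path3] := p_path.
  by rewrite p_path3 (e_sym x2) e12 (e_sym x1) e01 nbr0 // !inE eqxx !orbT.
have nbr1 : {in S, forall y, e x1 y = (y \in [:: x0; x2; x3])}.
  by have [? [? [? [? [? [[-> -> -> -> _]]]]]]]
    := tri _ p1_long (esym (congr1 size def_p)).
have nbr2 : {in S, forall y, e x2 y = (y \in [:: x1; x0; x3])}.
  by have [? [? [? [? [? [[-> -> -> -> _]]]]]]]
    := tri _ p2_long (esym (congr1 size def_p)).
have K4 x s : {in S, forall y, e x y = (y \in s)} ->
    {subset s <= [:: x0; x1; x2; x3]} -> size s = 3 ->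
    deg S x + deg (S :\: [set x0; x1; x2]) x <= 4.
  move=> nbr sub sz_s; apply: (@leq_add _ _ 3 1).
    by rewrite -sz_s; apply: deg_sub => y Sy; rewrite nbr.
  apply: (@deg_sub _ [:: x3]) => y; rewrite !inE !negb_or.
  case/andP=> /andP[/andP[y0 y1] y2] Sy; rewrite nbr // => /sub.
  by rewrite !inE (negPf y0) (negPf y1) (negPf y2).
exists [set x0; x1; x2]; split.
- by rewrite !subUset !sub1set S0 S1.
- by apply/set0Pn; exists x0; rewrite !inE eqxx.
move=> x; rewrite !inE => /orP[/orP[]|] /eqP->.
- by apply: K4 nbr0 _ _ => // y yP; rewrite inE yP orbT.
- by apply: K4 nbr1 _ _ => // y; rewrite !inE => /or3P[] ->; rewrite ?orbT.
- by apply: K4 nbr2 _ _ => // y; rewrite !inE => /or3P[] ->; rewrite ?orbT.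
Qed.

(** Removable sets are deleted one after another; each deleted vertex lowers the degree sum by at
    most 4 on average over its set. *)
Lemma degsum_le (S : {set T}) :
  path8_free e -> no_cycle_in S 6 -> degsum S <= 4 * #|S|.
Proof.
move=> P8; have [n] := ubnP #|S|; elim: n S => // n IHn S lt_Sn no6.
have [-> | nzS] := eqVneq S set0; first by rewrite /degsum big_set0.
have [A [sAS nzA degA]] := removable_exists P8 no6 nzS.
have ltS : #|S :\: A| + #|A| = #|S|.
  by rewrite cardsD (setIidPr sAS) subnK // subset_leq_card.
rewrite (degsumD sAS) -ltS mulnDr leq_add //.
  apply: IHn => [|q sz_q q_uniq q_S].
    by rewrite -card_gt0 in nzA; lia.
  by apply: no6 => // y /q_S /setDP[].
by rewrite mulnC -sum_nat_const; apply: leq_sum.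
Qed.

End Density.

(** * Bipartite graphs without hexagons *)

Section BipartiteDensity.

Variables (T : finType) (e : rel T) (side : pred T).
Hypotheses (e_sym : symmetric e)
  (e_side : forall x y, e x y -> side y = ~~ side x).
Hypotheses (P8 : path8_free e) (no6 : no_cycle_in e setT 6).

Definition cross (A B : {set T}) : nat := \sum_(x in A) deg e B x.

Lemma crossC A B : cross A B = cross B A.
Proof.
rewrite /cross /deg exchange_big; apply: eq_bigr => x _.
by apply: eq_bigr => y _; rewrite e_sym.
Qed.

(** An end of a longest path has its neighbours at odd positions of the path, hence among 1, 3, 5,
    and an edge to position 5 would close a hexagon. *)
Lemma low_degree (S : {set T}) :
  S != set0 -> exists2 x, x \in S & deg e S x <= 2.
Proof.
move=> nzS; have [p p_long p_size] := longest_exists P8 nzS.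
have [/and3P[p_uniq p_path p_S] _] := p_long.
case: p p_size p_uniq p_path p_S p_long =>
  // x p p_size p_uniq p_path p_S p_long.
have Sx : x \in S by case/andP: p_S.
exists x => //; rewrite leqNgt; apply/negP=> deg_gt2.
have {deg_gt2}: 2 < count (e x) (x :: p).
  exact: leq_trans deg_gt2 (deg_longest e_sym p_long).
pose p_ i := nth x (x :: p) i.
have stepP i : i < size p -> e (p_ i) (p_ i.+1).
  by move=> lt_i; have /(pathP x)/(_ _ lt_i) := p_path.
have side_p i : i <= size p -> side (p_ i) = odd i (+) side x.
  elim: i => // i IHi lt_i; rewrite (e_side (stepP i lt_i)) IHi ?(ltnW lt_i) //.
  by rewrite /= addNb.
have odd_nbr i : i <= size p -> e x (p_ i) -> odd i.
  by move=> le_i /e_side; rewrite side_p //; case: (odd i) (side x) => [] [].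
have [/andP[lt5 ex5] | not5] := boolP ((5 <= size p) && e x (p_ 5)).
  have sz6 : size (take 6 (x :: p)) = 6 by rewrite size_takel.
  have /negP[] := no6 sz6 (take_uniq _ p_uniq) (fun y _ => in_setT y).
  rewrite /= rcons_path take_path //= (last_nth x) size_takel //=.
  by rewrite nth_take // e_sym.
rewrite -[x :: p](mkseq_nth x) /mkseq count_map ltnNge.
have -> // : count (preim (nth x (x :: p)) (e x)) (iota 0 (size (x :: p))) <= 2.
apply: (@leq_trans (count (fun i => odd i && (i != 5)) (iota 0 (size p).+1))).
  rewrite -!size_filter; apply: uniq_leq_size; first
    by rewrite filter_uniq ?iota_uniq.
  move=> i; rewrite !mem_filter mem_iota /= => /andP[exi lt_i].
  rewrite lt_i (odd_nbr i) // andbT; apply: contraNneq not5 => i5.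
  by rewrite -i5 -ltnS lt_i exi.
by case/andP: p_size => _ /=; case: (size p) => [|[|[|[|[|[|[|]]]]]]].
Qed.

Lemma deg_le (S A : {set T}) x : A \subset S -> deg e A x <= deg e S x.
Proof. by move=> sAS; rewrite (degD e x sAS) leq_addr. Qed.

Lemma deg_le_card (S : {set T}) x : deg e S x <= #|S|.
Proof. by rewrite degE subset_leq_card //; apply/subsetP=> y;
  rewrite inE => /andP[]. Qed.

Lemma deg_full (S : {set T}) x : deg e S x = #|S| -> {in S, forall y, e x y}.
Proof.
rewrite degE => card_S y Sy.
have sub : [set y in S | e x y] \subset S
  by apply/subsetP=> z; rewrite inE => /andP[].
have /setP/(_ y) : [set y in S | e x y] = S
  by apply/eqP; rewrite eqEcard sub card_S /=.
by rewrite inE Sy.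
Qed.

Lemma cross1 (A B : {set T}) x :
  x \in A -> cross A B = deg e B x + cross (A :\ x) B.
Proof. by move=> Ax; rewrite /cross (big_setD1 x). Qed.

(** Degrees 2, [#|B|] and [#|B|] exceed the bound by exactly 1. In that extreme case the two
    neighbours of [x] and one more vertex of [B] form a hexagon with the three vertices of [A]. *)
Lemma cross_small c (A B : {set T}) x : #|A| = 3 -> 2 < #|B| ->
    {in A, forall y, side y = c} -> {in B, forall y, side y = ~~ c} ->
    x \in A -> deg e B x <= 2 ->
  cross A B + 5 <= 2 * (#|A| + #|B|).
Proof.
move=> card_A card_B sA sB Ax deg_x.
have /eqP/cards2P[a [a' [a'_a def_A]]] : #|A :\ x| = 2.
  by move: (cardsD1 x A); rewrite Ax card_A => -[].
have [/andP[xa Aa] /andP[xa' Aa']] :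
    (a != x) && (a \in A) /\ (a' != x) && (a' \in A).
  by rewrite -!in_setD1 def_A !inE !eqxx orbT.
rewrite (cross1 B Ax) def_A /cross big_setU1 ?inE //= big_set1.
have := deg_le_card B a; have := deg_le_card B a'; rewrite card_A.
have [full | ] :=
    boolP [&& deg e B x == 2, deg e B a == #|B| & deg e B a' == #|B|]; last
      by lia.
case/and3P: full => /eqP; rewrite degE => /eqP/cards2P[b1 [b2 [b21 nbr_x]]].
move=> /eqP/deg_full ea /eqP/deg_full ea' _ _.
have [Bb1 ex1] : b1 \in B /\ e x b1.
  by apply/andP; have := set21 b1 b2; rewrite -nbr_x inE.
have [Bb2 ex2] : b2 \in B /\ e x b2.
  by apply/andP; have := set22 b1 b2; rewrite -nbr_x inE.
have [b3] : exists b3, b3 \in B :\: [set b1; b2].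
  apply/set0Pn; rewrite -card_gt0 cardsD.
  have := subset_leq_card (subsetIr B [set b1; b2]); rewrite cards2;
    clear -card_B; lia.
rewrite !inE negb_or => /andP[/andP[b31 b32] Bb3].
have AB y z : y \in A -> z \in B -> (y == z) = false.
  move=> Ay Bz; apply/eqP=> yz; have := sA y Ay; rewrite yz sB //; by case: (c).
have q_uniq : uniq [:: a; b1; x; b2; a'; b3].
  rewrite /= !inE !negb_or (eq_sym b1 x) (eq_sym b1 a') (eq_sym b2 a').
  rewrite (AB a b1) // (AB a b2) // (AB a b3) // (AB x b1) // (AB x b2) //.
  rewrite (AB x b3) // (AB a' b1) // (AB a' b2) // (AB a' b3) //=.
  rewrite b21 (eq_sym b1 b3) b31 (eq_sym b2 b3) b32.
  by rewrite xa (eq_sym x) xa' a'_a.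
have sz6 : size [:: a; b1; x; b2; a'; b3] = 6 by [].
have /negP[] := no6 sz6 q_uniq (fun y _ => in_setT y).
by rewrite /= !(e_sym b1, e_sym b2, e_sym b3) !(ea, ea') // ex1 ex2.
Qed.

(** Deleting a vertex of degree at most 2 from a side of more than three vertices lowers the
    right-hand side by 2. The constant 5 is what the base case, a side of exactly three, allows. *)
Lemma cross_le c (A B : {set T}) : 2 < #|A| -> 2 < #|B| ->
    {in A, forall y, side y = c} -> {in B, forall y, side y = ~~ c} ->
  cross A B + 5 <= 2 * (#|A| + #|B|).
Proof.
have [n] := ubnP (#|A| + #|B|).
elim: n c A B => // n IHn c A B lt_n card_A card_B sA sB.
have nz : A :|: B != set0.
  by rewrite -card_gt0; have := subset_leq_card (subsetUl A B); clear -card_A;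
    lia.
have [x AB_x deg_x] := low_degree nz.
wlog Ax : c A B lt_n card_A card_B sA sB {nz} AB_x deg_x / x \in A => [IH|].
  have [/(IH c A B lt_n)|Bx] := setUP AB_x; first exact.
  rewrite crossC addnC [#|A| + _]addnC addnC; apply: (IH (~~ c)) => //.
  - by rewrite addnC.
  - by move=> y /sA->; rewrite negbK.
  - by rewrite setUC.
  - by rewrite setUC.
have {}deg_x : deg e B x <= 2 := leq_trans (deg_le x (subsetUr A B)) deg_x.
have := cardsD1 x A; rewrite Ax => card_Ax.
have [A3 | ] := eqVneq #|A| 3; first exact: cross_small sA sB Ax deg_x.
move=> A_n3; rewrite (cross1 B Ax).
have := IHn c (A :\ x) B; rewrite (_ : #|A :\ x| = #|A|.-1) ?card_Ax //.
have sAx : {in A :\ x, forall y, side y = c} by move=> y /setD1P[_]; apply: sA.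
move=> IH; have := IH _ _ card_B sAx sB; clear -deg_x card_A card_Ax A_n3 lt_n;
  lia.
Qed.

End BipartiteDensity.

(** * Case trees for the 6 + 8 and 7 + 7 splits *)

(* A case tree on the colours of the pairs of a labelled vertex set, whose
   leaves are monochromatic paths.  Colour 0 does not occur between the two
   sides, so [Cross] branches on colours 1 and 2 only; [Inner] branches on all
   three. *)
Inductive certificate :=
  | Mono of nat & seq nat
  | Cross of nat & nat & certificate & certificate
  | Inner of nat & nat & certificate & certificate & certificate.

Fixpoint refutes n (side : pred nat) (known : seq (nat * nat * nat)) t : bool :=
  match t with
  | Mono c p =>
    [&& size p == 8, uniq p, all (fun i => i < n) p &
      sorted (fun i j => ((i, j, c) \in known) || ((j, i, c) \in known)) p]
  | Cross i j t1 t2 =>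
    [&& i < n, j < n, side i != side j,
      refutes n side ((i, j, 1) :: known) t1 &
      refutes n side ((i, j, 2) :: known) t2]
  | Inner i j t0 t1 t2 =>
    [&& i < n, j < n, i != j,
      refutes n side ((i, j, 0) :: known) t0,
      refutes n side ((i, j, 1) :: known) t1 &
      refutes n side ((i, j, 2) :: known) t2]
  end.

Section Refutation.

Variables (n : nat) (side : pred nat) (col : nat -> nat -> nat).
Hypothesis col_sym : forall i j, col i j = col j i.
Hypothesis col_lt3 : forall i j, col i j < 3.
Hypothesis col_cross : forall i j, i < n -> j < n -> side i != side j ->
  col i j != 0.

Definition agrees (a : nat * nat * nat) : bool :=
  (a.1.1 != a.1.2) && (col a.1.1 a.1.2 == a.2).

Lemma refutesP known t : all agrees known -> refutes n side known t ->
  exists c p, [/\ size p = 8, uniq p, all (fun i => i < n) p &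
                  sorted (fun i j => (i != j) && (col i j == c)) p].
Proof.
elim: t known => [c p|i j t1 IH1 t2 IH2|i j t0 IH0 t1 IH1 t2 IH2] known k_ok /=.
- case/and4P=> /eqP sz_p p_uniq p_lt p_path; exists c, p; split=> //.
  apply: sub_sorted p_path => i j /orP[] /(allP k_ok) /andP[/= neq_ij eq_c].
    by rewrite neq_ij.
  by rewrite eq_sym neq_ij col_sym.
- case/and5P=> lt_i lt_j side_ij r1 r2.
  have neq_ij : i != j by apply: contraNneq side_ij => ->.
  have := col_lt3 i j; have := col_cross lt_i lt_j side_ij.
  case def_c: (col i j) => [|[|[|//]]] // _ _.
    by apply: IH1 r1; rewrite /= /agrees /= neq_ij def_c.
  by apply: IH2 r2; rewrite /= /agrees /= neq_ij def_c.
case/and5P=> lt_i lt_j neq_ij r0 /andP[r1 r2].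
have := col_lt3 i j; case def_c: (col i j) => [|[|[|//]]] // _.
- by apply: IH0 r0; rewrite /= /agrees /= neq_ij def_c.
- by apply: IH1 r1; rewrite /= /agrees /= neq_ij def_c.
by apply: IH2 r2; rewrite /= /agrees /= neq_ij def_c.
Qed.

End Refutation.

(** No [Inner] node occurs: the two colours on the pairs between the sides already force a path. *)
Definition certificate_7_7 : certificate :=
  Cross 2 10 (Cross 9 10 (Mono 1 [:: 9;10;2;1;0;5;4;3]) (Cross 3 8
  (Mono 1 [:: 10;2;1;0;5;4;3;8]) (Cross 7 10 (Mono 1 [:: 7;10;2;1;0;5;4;3])
  (Cross 1 6 (Mono 1 [:: 10;2;3;4;5;0;1;6]) (Cross 1 8
  (Mono 1 [:: 10;2;3;4;5;0;1;8]) (Cross 3 7 (Mono 1 [:: 10;2;1;0;5;4;3;7])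
  (Cross 6 11 (Cross 5 6 (Mono 1 [:: 4;3;2;1;0;5;6;11])
  (Mono 2 [:: 5;6;1;8;3;7;10;9])) (Mono 2 [:: 9;10;7;3;8;1;6;11])))))))) (Cross
  4 11 (Cross 3 7 (Mono 1 [:: 11;4;5;0;1;2;3;7]) (Cross 9 11
  (Mono 1 [:: 9;11;4;3;2;1;0;5]) (Cross 5 8 (Mono 1 [:: 11;4;3;2;1;0;5;8])
  (Cross 6 11 (Mono 1 [:: 6;11;4;3;2;1;0;5]) (Cross 5 7
  (Mono 1 [:: 11;4;3;2;1;0;5;7]) (Cross 3 6 (Mono 1 [:: 11;4;5;0;1;2;3;6])
  (Cross 9 12 (Cross 1 9 (Mono 1 [:: 2;3;4;5;0;1;9;12])
  (Mono 2 [:: 1;9;11;6;3;7;5;8])) (Mono 2 [:: 8;5;7;3;6;11;9;12])))))))) (Cross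
  0 13 (Cross 5 8 (Mono 1 [:: 13;0;1;2;3;4;5;8]) (Cross 8 13
  (Mono 1 [:: 8;13;0;1;2;3;4;5]) (Cross 9 13 (Mono 1 [:: 9;13;0;1;2;3;4;5])
  (Cross 1 9 (Mono 1 [:: 13;0;5;4;3;2;1;9]) (Cross 5 7
  (Mono 1 [:: 13;0;1;2;3;4;5;7]) (Cross 1 4 (Cross 3 6
  (Mono 1 [:: 13;0;5;4;1;2;3;6]) (Cross 1 6 (Mono 1 [:: 13;0;5;4;3;2;1;6])
  (Mono 2 [:: 7;5;8;13;9;1;6;3]))) (Mono 2 [:: 7;5;8;13;9;1;4;11]))))))) (Cross
  4 12 (Cross 5 6 (Mono 1 [:: 12;4;3;2;1;0;5;6]) (Cross 3 7
  (Mono 1 [:: 12;4;5;0;1;2;3;7]) (Cross 6 12 (Mono 1 [:: 6;12;4;3;2;1;0;5])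
  (Cross 5 8 (Mono 1 [:: 12;4;3;2;1;0;5;8]) (Cross 3 8
  (Mono 1 [:: 12;4;5;0;1;2;3;8]) (Cross 7 10 (Cross 9 12
  (Mono 1 [:: 9;12;4;3;2;1;0;5]) (Cross 1 7 (Mono 1 [:: 2;3;4;5;0;1;7;10])
  (Mono 2 [:: 1;7;3;8;5;6;12;9]))) (Mono 2 [:: 12;6;5;8;3;7;10;2]))))))) (Cross
  2 11 (Cross 9 11 (Mono 1 [:: 9;11;2;1;0;5;4;3]) (Cross 1 7
  (Mono 1 [:: 11;2;3;4;5;0;1;7]) (Cross 3 8 (Mono 1 [:: 11;2;1;0;5;4;3;8])
  (Cross 3 9 (Mono 1 [:: 11;2;1;0;5;4;3;9]) (Cross 1 8
  (Mono 1 [:: 11;2;3;4;5;0;1;8]) (Mono 2 [:: 7;1;8;3;9;11;4;12])))))) (Cross 0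
  12 (Cross 1 8 (Mono 1 [:: 12;0;5;4;3;2;1;8]) (Cross 1 7
  (Mono 1 [:: 12;0;5;4;3;2;1;7]) (Cross 7 12 (Mono 1 [:: 7;12;0;1;2;3;4;5])
  (Mono 2 [:: 8;1;7;12;4;11;2;10])))) (Cross 8 10 (Cross 0 10
  (Mono 1 [:: 5;4;3;2;1;0;10;8]) (Cross 6 10 (Cross 8 12 (Cross 2 12
  (Mono 1 [:: 5;0;1;2;12;8;10;6]) (Cross 9 11 (Cross 7 12 (Cross 9 10 (Cross 6
  11 (Cross 6 13 (Mono 1 [:: 7;12;8;10;9;11;6;13])
  (Mono 2 [:: 6;13;0;10;2;11;4;12])) (Mono 2 [:: 6;11;4;12;2;10;0;13]))
  (Mono 2 [:: 9;10;2;11;4;12;0;13])) (Mono 2 [:: 7;12;4;11;2;10;0;13]))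
  (Mono 2 [:: 9;11;4;12;2;10;0;13]))) (Mono 2 [:: 8;12;4;11;2;10;0;13]))
  (Mono 2 [:: 6;10;2;11;4;12;0;13]))) (Mono 2 [:: 8;10;2;11;4;12;0;13]))))))).

(** Here the pairs between the sides are not enough: if three of the 6 vertices send only colour 1
    to the other side and the remaining three only colour 2, an alternating path has at most 7
    vertices. The [Inner] nodes therefore branch inside the side of 8, and the leaves of colour 0
    run through all of that side. *)
Definition certificate_6_8 : certificate :=
  Cross 5 7 (Cross 4 9 (Mono 1 [:: 7;5;0;1;2;3;4;9]) (Cross 4 10
  (Mono 1 [:: 7;5;0;1;2;3;4;10]) (Cross 0 9 (Mono 1 [:: 7;5;4;3;2;1;0;9])
  (Cross 0 12 (Mono 1 [:: 7;5;4;3;2;1;0;12]) (Cross 7 12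
  (Mono 1 [:: 4;3;2;1;0;5;7;12]) (Cross 7 13 (Mono 1 [:: 4;3;2;1;0;5;7;13])
  (Cross 6 10 (Cross 2 10 (Mono 1 [:: 3;4;5;0;1;2;10;6])
  (Mono 2 [:: 2;10;4;9;0;12;7;13])) (Mono 2 [:: 6;10;4;9;0;12;7;13]))))))))
  (Cross 1 7 (Cross 0 9 (Mono 1 [:: 7;1;2;3;4;5;0;9]) (Cross 2 9
  (Mono 1 [:: 7;1;0;5;4;3;2;9]) (Cross 2 11 (Mono 1 [:: 7;1;0;5;4;3;2;11])
  (Cross 7 11 (Mono 1 [:: 2;3;4;5;0;1;7;11]) (Cross 0 13
  (Mono 1 [:: 7;1;2;3;4;5;0;13]) (Cross 6 13 (Cross 4 13
  (Mono 1 [:: 5;0;1;2;3;4;13;6]) (Mono 2 [:: 4;13;0;9;2;11;7;5]))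
  (Mono 2 [:: 6;13;0;9;2;11;7;5]))))))) (Cross 2 12 (Cross 1 8
  (Mono 1 [:: 12;2;3;4;5;0;1;8]) (Cross 3 7 (Mono 1 [:: 12;2;1;0;5;4;3;7])
  (Cross 3 6 (Mono 1 [:: 12;2;1;0;5;4;3;6]) (Cross 7 12
  (Mono 1 [:: 7;12;2;1;0;5;4;3]) (Cross 8 12 (Mono 1 [:: 8;12;2;1;0;5;4;3])
  (Cross 1 6 (Mono 1 [:: 12;2;3;4;5;0;1;6]) (Cross 0 12 (Cross 6 12
  (Mono 1 [:: 6;12;0;1;2;3;4;5]) (Cross 0 3 (Cross 2 5 (Cross 4 12 (Cross 3 8
  (Mono 1 [:: 12;4;5;2;1;0;3;8]) (Cross 5 8 (Mono 1 [:: 12;4;3;2;1;0;5;8])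
  (Cross 5 6 (Mono 1 [:: 12;4;3;2;1;0;5;6]) (Inner 3 11 (Inner 1 13 (Inner 9 12
  (Inner 1 10 (Inner 5 11 (Inner 3 13 (Inner 5 9
  (Mono 0 [:: 10;1;13;3;11;5;9;12]) (Mono 1 [:: 12;4;3;2;1;0;5;9])
  (Mono 2 [:: 12;8;3;7;1;6;5;9])) (Mono 1 [:: 12;4;5;2;1;0;3;13])
  (Mono 2 [:: 12;8;5;7;1;6;3;13])) (Mono 1 [:: 12;4;3;2;1;0;5;11])
  (Mono 2 [:: 12;8;3;7;1;6;5;11])) (Mono 1 [:: 12;4;5;2;3;0;1;10])
  (Mono 2 [:: 12;8;5;7;3;6;1;10])) (Mono 1 [:: 9;12;0;1;2;3;4;5])
  (Mono 2 [:: 9;12;6;1;7;3;8;5])) (Mono 1 [:: 12;4;5;2;3;0;1;13])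
  (Mono 2 [:: 12;8;5;7;3;6;1;13])) (Mono 1 [:: 12;4;5;2;1;0;3;11])
  (Mono 2 [:: 12;8;5;7;1;6;3;11]))))) (Mono 2 [:: 4;12;8;1;6;3;7;5]))
  (Mono 2 [:: 2;5;7;1;8;12;6;3])) (Mono 2 [:: 0;3;6;1;8;12;7;5])))
  (Mono 2 [:: 0;12;8;1;6;3;7;5])))))))) (Cross 3 6 (Cross 2 11
  (Mono 1 [:: 6;3;4;5;0;1;2;11]) (Cross 4 10 (Mono 1 [:: 6;3;2;1;0;5;4;10])
  (Cross 2 9 (Mono 1 [:: 6;3;4;5;0;1;2;9]) (Cross 6 10
  (Mono 1 [:: 4;5;0;1;2;3;6;10]) (Cross 4 12 (Mono 1 [:: 6;3;2;1;0;5;4;12])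
  (Cross 5 6 (Cross 4 11 (Mono 1 [:: 6;5;0;1;2;3;4;11]) (Cross 0 12
  (Mono 1 [:: 6;5;4;3;2;1;0;12]) (Cross 0 9 (Mono 1 [:: 6;5;4;3;2;1;0;9])
  (Mono 2 [:: 12;0;9;2;11;4;10;6])))) (Mono 2 [:: 7;5;6;10;4;12;2;9])))))))
  (Cross 3 8 (Cross 2 10 (Mono 1 [:: 8;3;4;5;0;1;2;10]) (Cross 8 12
  (Mono 1 [:: 4;5;0;1;2;3;8;12]) (Cross 2 11 (Mono 1 [:: 8;3;4;5;0;1;2;11])
  (Cross 4 10 (Mono 1 [:: 8;3;2;1;0;5;4;10]) (Cross 1 8 (Cross 8 10
  (Mono 1 [:: 2;3;4;5;0;1;8;10]) (Cross 4 9 (Mono 1 [:: 8;3;2;1;0;5;4;9])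
  (Cross 0 9 (Mono 1 [:: 8;1;2;3;4;5;0;9]) (Mono 2 [:: 0;9;4;10;8;12;2;11]))))
  (Mono 2 [:: 5;7;1;8;12;2;10;4])))))) (Cross 5 6 (Cross 0 10
  (Mono 1 [:: 6;5;4;3;2;1;0;10]) (Cross 4 13 (Mono 1 [:: 6;5;0;1;2;3;4;13])
  (Cross 0 11 (Mono 1 [:: 6;5;4;3;2;1;0;11]) (Cross 6 11
  (Mono 1 [:: 4;3;2;1;0;5;6;11]) (Cross 4 10 (Mono 1 [:: 6;5;0;1;2;3;4;10])
  (Mono 2 [:: 13;4;10;0;11;6;3;8])))))) (Cross 8 12 (Cross 5 8
  (Mono 1 [:: 4;3;2;1;0;5;8;12]) (Cross 4 12 (Mono 1 [:: 5;0;1;2;3;4;12;8])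
  (Cross 1 4 (Cross 6 12 (Cross 0 12 (Mono 1 [:: 5;4;3;2;1;0;12;6]) (Cross 1 8
  (Mono 1 [:: 3;4;5;0;1;8;12;6]) (Cross 7 12 (Cross 2 5 (Cross 1 6
  (Mono 1 [:: 3;2;5;0;1;6;12;7]) (Cross 0 3 (Cross 3 7
  (Mono 1 [:: 5;2;1;0;3;7;12;6]) (Inner 1 12 (Inner 3 12 (Inner 5 12 (Cross 4
  13 (Cross 6 13 (Mono 1 [:: 6;13;4;1;0;3;2;5]) (Cross 2 13 (Cross 8 13
  (Mono 1 [:: 8;13;2;1;0;3;4;5]) (Cross 0 13 (Inner 1 11 (Inner 3 11 (Inner 5 9
  (Inner 9 13 (Inner 1 10 (Mono 0 [:: 13;9;5;12;3;11;1;10])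
  (Mono 1 [:: 13;4;5;2;3;0;1;10]) (Mono 2 [:: 13;8;5;7;3;6;1;10]))
  (Mono 1 [:: 9;13;0;1;2;3;4;5]) (Mono 2 [:: 9;13;6;1;7;3;8;5]))
  (Mono 1 [:: 13;4;3;2;1;0;5;9]) (Mono 2 [:: 13;8;3;7;1;6;5;9]))
  (Mono 1 [:: 13;4;5;2;1;0;3;11]) (Mono 2 [:: 13;8;5;7;1;6;3;11]))
  (Mono 1 [:: 13;4;5;2;3;0;1;11]) (Mono 2 [:: 13;8;5;7;3;6;1;11]))
  (Mono 2 [:: 0;13;6;1;7;3;8;5]))) (Mono 2 [:: 2;13;6;1;7;3;8;5]))) (Cross 6 13
  (Cross 0 13 (Mono 1 [:: 3;2;1;0;13;6;12;7]) (Cross 7 13 (Cross 2 13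
  (Mono 1 [:: 3;0;1;2;13;6;12;7]) (Cross 8 13 (Inner 5 13 (Inner 3 13 (Cross 6
  10 (Cross 0 10 (Mono 1 [:: 1;0;10;6;12;7;13;8]) (Cross 7 10 (Cross 8 10
  (Cross 2 10 (Mono 1 [:: 1;2;10;6;12;7;13;8]) (Cross 4 10
  (Mono 1 [:: 1;4;10;6;12;7;13;8]) (Inner 1 10 (Inner 3 10 (Cross 6 9 (Cross 2
  9 (Mono 1 [:: 2;9;6;10;7;12;8;13]) (Cross 0 9
  (Mono 1 [:: 0;9;6;10;7;12;8;13]) (Cross 7 9 (Inner 11 13 (Inner 1 9
  (Mono 0 [:: 11;13;5;12;3;10;1;9]) (Mono 1 [:: 1;9;6;10;7;12;8;13])
  (Mono 2 [:: 1;9;0;10;2;12;4;13])) (Mono 1 [:: 11;13;6;9;7;10;8;12])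
  (Mono 2 [:: 11;13;0;9;2;10;4;12])) (Mono 2 [:: 7;9;0;10;2;12;4;13])))) (Cross
  0 9 (Cross 4 9 (Cross 8 9 (Mono 1 [:: 8;9;0;1;2;3;4;5]) (Inner 3 11 (Inner 9
  10 (Mono 0 [:: 9;10;1;12;5;13;3;11]) (Mono 1 [:: 0;9;10;6;12;7;13;8])
  (Mono 2 [:: 6;9;10;0;12;2;13;4])) (Mono 1 [:: 9;4;5;2;1;0;3;11])
  (Mono 2 [:: 9;8;5;7;1;6;3;11]))) (Mono 2 [:: 4;9;6;1;7;3;8;5]))
  (Mono 2 [:: 0;9;6;1;7;3;8;5]))) (Mono 1 [:: 0;3;10;6;12;7;13;8])
  (Mono 2 [:: 6;3;10;0;12;2;13;4])) (Mono 1 [:: 0;1;10;6;12;7;13;8])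
  (Mono 2 [:: 6;1;10;0;12;2;13;4])))) (Mono 2 [:: 1;8;10;0;12;2;13;4]))
  (Mono 2 [:: 1;7;10;0;12;2;13;4]))) (Cross 2 10 (Cross 8 10
  (Mono 1 [:: 8;10;2;1;0;3;4;5]) (Cross 0 10 (Cross 4 10 (Inner 3 11 (Inner 9
  10 (Inner 1 9 (Mono 0 [:: 11;3;13;5;12;1;9;10])
  (Mono 1 [:: 10;4;5;2;3;0;1;9]) (Mono 2 [:: 10;8;5;7;3;6;1;9]))
  (Mono 1 [:: 9;10;0;1;2;3;4;5]) (Mono 2 [:: 9;10;6;1;7;3;8;5]))
  (Mono 1 [:: 10;4;5;2;1;0;3;11]) (Mono 2 [:: 10;8;5;7;1;6;3;11]))
  (Mono 2 [:: 4;10;6;1;7;3;8;5])) (Mono 2 [:: 0;10;6;1;7;3;8;5])))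
  (Mono 2 [:: 2;10;6;1;7;3;8;5]))) (Mono 1 [:: 2;1;0;3;13;6;12;7])
  (Mono 2 [:: 7;1;6;3;13;0;12;2])) (Mono 1 [:: 2;1;0;5;13;6;12;7])
  (Mono 2 [:: 7;1;6;5;13;0;12;2])) (Mono 2 [:: 3;6;1;8;13;0;12;2])))
  (Mono 2 [:: 3;6;1;7;13;0;12;2]))) (Mono 2 [:: 3;7;1;6;13;4;12;0])))
  (Mono 1 [:: 4;3;2;1;0;5;12;6]) (Mono 2 [:: 8;3;7;1;6;5;12;0]))
  (Mono 1 [:: 4;5;2;1;0;3;12;6]) (Mono 2 [:: 8;5;7;1;6;3;12;0]))
  (Mono 1 [:: 4;5;2;3;0;1;12;6]) (Mono 2 [:: 8;5;7;3;6;1;12;0])))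
  (Mono 2 [:: 12;0;3;6;1;7;5;8]))) (Mono 2 [:: 12;2;5;6;3;8;1;7]))
  (Mono 2 [:: 5;6;3;8;1;7;12;0])))) (Mono 2 [:: 1;7;5;8;3;6;12;2]))
  (Mono 2 [:: 3;6;5;7;1;4;12;2])))) (Mono 2 [:: 1;7;5;6;3;8;12;2]))))))).

Definition hexagon : seq (nat * nat * nat) :=
  [:: (0, 1, 1); (1, 2, 1); (2, 3, 1); (3, 4, 1); (4, 5, 1); (5, 0, 1)].

(* Labels 0-5 are the alternating hexagon; the side of m vertices consists of
   0, 2, 4 and m - 3 further vertices. *)
Definition split_side (m i : nat) : bool :=
  (i \in [:: 0; 2; 4]) || (6 <= i < m + 3).

Lemma certificate_7_7P : refutes 14 (split_side 7) hexagon certificate_7_7.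
Proof. by vm_compute. Qed.

Lemma certificate_6_8P : refutes 14 (split_side 6) hexagon certificate_6_8.
Proof. by vm_compute. Qed.

Lemma third_color (r b : 'I_3) : r != b ->
  exists g, forall c, c != r -> c != b -> c = g.
Proof.
move=> rb; have /cards1P[g def_g] : #|~: [set r; b]| == 1.
  by have := cardsC [set r; b]; rewrite cards2 rb card_ord; lia.
exists g => c cr cb; apply/set1P; rewrite -def_g !inE negb_or cr //.
Qed.

Lemma card_list (T : finType) (A : {pred T}) (s : seq T) :
  uniq s -> s =i A -> #|A| = size s.
Proof. by move=> /card_uniqP<- sA; apply/esym/eq_card. Qed.

Section Coloring.

Variables (T : finType) (col : T -> T -> 'I_3).
Hypothesis col_sym : forall x y, col x y = col y x.

Definition in_color (c : 'I_3) (x y : T) : bool := (x != y) && (col x y == c).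

Lemma in_color_sym c : symmetric (in_color c).
Proof. by move=> x y; rewrite /in_color eq_sym col_sym. Qed.

Lemma in_color_irr c : irreflexive (in_color c).
Proof. by move=> x; rewrite /in_color eqxx. Qed.

Lemma sum_in_color x y : x != y -> \sum_(c : 'I_3) in_color c x y = 1.
Proof.
move=> xy; rewrite (bigD1 (col x y)) //= /in_color xy eqxx big1 // => c.
by rewrite eq_sym => /negPf->.
Qed.

Hypothesis no_path8 : forall c, path8_free (in_color c).
Hypothesis card_T : #|T| = 14.

(** The 48 or 49 pairs across the split carry only two colours, so one of them has at least 24, more
    than the 2 * 14 - 5 = 23 that [cross_le] allows without a hexagon. *)
Lemma split_hexagon r (A : {set T}) : 5 < #|A| < 8 ->
    {in A & ~: A, forall x y, col x y != r} ->
  exists2 b, b != r & exists x0 x1 x2 x3 x4 x5,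
    [/\ uniq [:: x0; x1; x2; x3; x4; x5],
      cycle (in_color b) [:: x0; x1; x2; x3; x4; x5] &
      map (mem A) [:: x0; x1; x2; x3; x4; x5] =
        [:: true; false; true; false; true; false]].
Proof.
move=> card_A no_r.
pose e c x y := in_color c x y && ((y \in A) == (x \notin A)).
have e_sym c : symmetric (e c).
  by move=> x y; rewrite /e in_color_sym; case: (x \in A) (y \in A) => [] [].
have e_side c x y : e c x y -> (y \in A) = ~~ (x \in A) by case/andP=> _ /eqP.
have e_free c : path8_free (e c).
  move=> s sz_s s_uniq; apply: contra (no_path8 c sz_s s_uniq).
  by apply: sub_sorted => x y /andP[].
have card_AC := cardsC A; rewrite card_T in card_AC.
have sum_cross : \sum_(c : 'I_3) cross (e c) A (~: A) = #|A| * #|~: A|.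
  rewrite exchange_big /= -sum_nat_const; apply: eq_bigr => x Ax.
  rewrite /deg exchange_big /= -sum1_card; apply: eq_bigr => y;
    rewrite inE => A'y.
  have xy : x != y by apply: contraNneq A'y => <-.
  rewrite -[RHS](sum_in_color xy); apply: eq_bigr => c _.
  by rewrite /e Ax (negPf A'y) andbT.
have cross_r : cross (e r) A (~: A) = 0.
  rewrite /cross big1 // => x Ax; rewrite /deg big1 // => y A'y.
  by rewrite /e /in_color (negPf (no_r x y Ax A'y)) andbF.
have [b br cross_b] : exists2 b, b != r & 23 < cross (e b) A (~: A).
  have [/exists_inP // | ] := 
    boolP [exists (b | b != r), 23 < cross (e b) A (~: A)].
  rewrite negb_exists_in => /forall_inP le_cross.
  have : \sum_(c | c != r) cross (e c) A (~: A) <= \sum_(c in predC1 r) 23.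
    by apply: leq_sum => c /le_cross; rewrite -leqNgt.
  rewrite sum_nat_const cardC1 card_ord.
  by move: sum_cross; rewrite (bigD1 r) //= cross_r add0n => ->; nia.
exists b => //.
have [no6 | [q [sz_q q_uniq _ q_cyc]]] := no_cycleP (e b) setT 6.
  have A_side : {in A, forall y, (y \in A) = true} by [].
  have AC_side : {in ~: A, forall y, (y \in A) = ~~ true}.
    by move=> y; rewrite inE => /negPf.
  have := cross_le (@e_sym b) (@e_side b) (@e_free b) no6 _ _ A_side AC_side.
  clear -cross_b card_A card_AC; lia.
case: q sz_q q_uniq q_cyc =>
  [|x0 [|x1 [|x2 [|x3 [|x4 [|x5 [|//]]]]]]] // _ q_uniq.
move=> q_cyc; have col_cyc : cycle (in_color b) [:: x0; x1; x2; x3; x4; x5].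
  by apply: sub_cycle q_cyc => x y /andP[].
have /= /and5P[/e_side s1 /e_side s2 /e_side s3 /e_side s4 /andP[/e_side s5 _]]
  := q_cyc.
(* A rotation by one makes the hexagon start in [A], as the labels of [split_side] require. *)
have [A0 | A'0] := boolP (x0 \in A).
  by exists x0, x1, x2, x3, x4, x5; rewrite /= s5 s4 s3 s2 s1 A0.
exists x1, x2, x3, x4, x5, x0; split.
- by rewrite -(rot_uniq 1) in q_uniq.
- by rewrite -(rot_cycle 1) in col_cyc.
- by rewrite /= s5 s4 s3 s2 s1 (negPf A'0).
Qed.

(** Listing the hexagon, then the rest of [A], then the rest of its complement produces the labels
    of [split_side], so a case tree yields a monochromatic path. *)
Lemma no_split r (A : {set T}) : 5 < #|A| < 8 ->
    {in A & ~: A, forall x y, col x y != r} -> False.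
Proof.
move=> card_A no_r.
have [b br [x0 [x1 [x2 [x3 [x4 [x5]]]]]]] := split_hexagon card_A no_r.
set q := [:: x0; _; _; _; _; _] => -[q_uniq q_cyc /= [A0 A1 A2 A3 A4 A5]].
have [g def_g] := third_color (br : b != r).
pose rA := [seq x <- enum A | x \notin q].
pose rB := [seq x <- enum (~: A) | x \notin q].
pose s := q ++ rA ++ rB.
have rA_mem x : (x \in rA) = (x \notin q) && (x \in A)
  by rewrite mem_filter mem_enum.
have rB_mem x : (x \in rB) = (x \notin q) && (x \notin A).
  by rewrite mem_filter mem_enum in_setC.
have [rA_uniq rB_uniq] : uniq rA /\ uniq rB.
  by split; apply: filter_uniq; apply: enum_uniq.
have rA_A x : x \in rA -> x \in A by rewrite rA_mem => /andP[].
have rB_A x : x \in rB -> (x \in A) = false.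
  by rewrite rB_mem => /andP[_ /negPf].
have s_uniq : uniq s.
  rewrite !cat_uniq q_uniq rA_uniq rB_uniq.
  apply/and5P; split=> //; apply/hasPn=> x.
    by rewrite mem_cat rA_mem rB_mem => /orP[]/andP[].
  by move/rB_A=> Ax; apply/negP=> /rA_A; rewrite Ax.
have s_T : s =i T.
  by move=> x; rewrite !mem_cat rA_mem rB_mem; case: (x \in q); case: (x \in A).
have sz_s : size s = 14 by rewrite -card_T (card_list s_uniq s_T).
have card_rA : #|A| = size rA + 3.
  rewrite (@card_list _ A [seq x <- s | x \in A]) ?filter_uniq //; last first.
    by move=> x; rewrite mem_filter s_T andbT.
  have /all_filterP rA_all : all (mem A) rA by apply/allP.
  rewrite /s !filter_cat !size_cat rA_all /= A0 A1 A2 A3 A4 A5 /=.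
  have /eqP -> : [seq x <- rB | x \in A] == [::].
    by rewrite -[_ == _]negbK -has_filter; apply/hasPn=> x /rB_A->.
  by rewrite addn0 addnC.
(* The colours as the case trees number them: 0 is absent across the split, 1 is the colour of the
   hexagon, 2 is the third. *)
pose code c := if c == r then 0 else if c == b then 1 else 2.
pose f := nth x0 s.
have f_side i : i < 14 -> (f i \in A) = split_side #|A| i.
  rewrite /f /split_side !nth_cat /= => lt_i.
  case: ltnP => [|le6i].
    by case: i {lt_i} => [|[|[|[|[|[|//]]]]]] _.
  rewrite -(subnK le6i) addnK; set j := i - 6.
  have -> : (j + 6 \in [:: 0; 2; 4]) = false by rewrite addnC.
  rewrite card_rA -addnA ltn_add2r; case: ltnP => [lt_j | le_j].
    by apply: rA_A; rewrite mem_nth.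
  apply: rB_A; rewrite mem_nth //.
  move: sz_s; rewrite !size_cat /= /j; clear -lt_i le6i le_j; lia.
have code_sym i j : code (col (f i) (f j)) = code (col (f j) (f i))
  by rewrite col_sym.
have code_lt3 i j : code (col (f i) (f j)) < 3
  by rewrite /code; case: ifP => // _; case: ifP.
have code_cross i j : i < 14 -> j < 14 ->
    split_side #|A| i != split_side #|A| j -> code (col (f i) (f j)) != 0.
  move=> lt_i lt_j; rewrite -!f_side // => ij_A.
  suff: col (f i) (f j) != r by rewrite /code => /negPf->; case: ifP.
  move: ij_A; have [Ai|A'i] := boolP (f i \in A).
    by move=> A'j; apply: no_r => //; rewrite inE; case: (f j \in A) A'j.
  by move=> Aj; rewrite col_sym; apply: no_r; rewrite ?inE //;
    case: (f j \in A) Aj.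
have f_inj i j : i < 14 -> j < 14 -> (f i == f j) = (i == j).
  by move=> lt_i lt_j; rewrite nth_uniq ?sz_s.
have hex_ok : all (agrees (fun i j => code (col (f i) (f j)))) hexagon.
  have code_b : code b = 1 by rewrite /code (negPf br) eqxx.
  have /= /and5P[/andP[_ /eqP c0] /andP[_ /eqP c1] /andP[_ /eqP c2] /andP[_ /eqP
    c3]] := q_cyc.
  case/and3P=> /andP[_ /eqP c4] /andP[_ /eqP c5] _.
  by rewrite /= /agrees /= /f /= c0 c1 c2 c3 c4 c5 code_b.
have [t t_ref] : exists t, refutes 14 (split_side #|A|) hexagon t.
  have [-> | A7] := eqVneq #|A| 7; first
    by exists certificate_7_7; apply: certificate_7_7P.
  have -> : #|A| = 6 by clear -card_A A7; lia.
  by exists certificate_6_8; apply: certificate_6_8P.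
have [k [p [sz_p p_uniq p_lt p_path]]]
  := refutesP code_sym code_lt3 code_cross hex_ok t_ref.
have p_f_path : sorted (in_color (nth r [:: r; b; g] k)) (map f p).
  rewrite sorted_map; apply: sub_in_sorted p_lt p_path =>
    i j lt_i lt_j /andP[ij /eqP <-].
  rewrite /= /in_color f_inj // ij /code /=.
  have [-> | cr] := eqVneq (col (f i) (f j)) r; first exact: eqxx.
  have [-> | cb] := eqVneq (col (f i) (f j)) b; first exact: eqxx.
  by rewrite /= (def_g _ cb cr).
have := no_path8 (nth r [:: r; b; g] k) (etrans (size_map f p) sz_p).
rewrite p_f_path map_inj_in_uniq => [/(_ p_uniq) // | i j].
move=> /(allP p_lt) lt_i /(allP p_lt) lt_j /eqP.
by rewrite f_inj // => /eqP.
Qed.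



End Coloring.

(** * The neighbourhood of a hexagon *)

Definition graph_of (E : seq (nat * nat)) : rel nat :=
  fun i j => ((i, j) \in E) || ((j, i) \in E).

Definition hexagon_edges : seq (nat * nat) :=
  [:: (0, 1); (1, 2); (2, 3); (3, 4); (4, 5); (5, 0)].

(* Labels 6 and up denote vertices outside the hexagon. *)
Definition hexagon_plus (E : seq (nat * nat)) : bool :=
  has_path 8 8 (graph_of (hexagon_edges ++ E)).

Definition consecutive (i j : nat) : bool := graph_of hexagon_edges i j.

(** The maximal independent sets of the 6-cycle. *)
Definition independent_masks : seq (seq nat) :=
  [:: [:: 0; 2; 4]; [:: 1; 3; 5]; [:: 0; 3]; [:: 1; 4]; [:: 2; 5]].

Section Hexagon.

Variables (T : finType) (e : rel T).
Hypotheses (e_sym : symmetric e) (e_irr : irreflexive e) (P8 : path8_free e).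
Variables (x0 : T) (q : seq T).
Hypotheses (sz_q : size q = 6) (q_uniq : uniq q) (q_cyc : cycle e q).

Let q_ := nth x0 q.

Definition attached : {set T} := [set y | (y \notin q) && has (e y) q].

Definition attached_at (i : nat) : bool :=
  [exists y, (y \notin q) && e (nth x0 q i) y].

Lemma hexagon_plusF (E : seq (nat * nat)) y z :
    let s := q ++ [:: y; z] in
    y \notin q -> z \notin q -> y != z ->
    all (fun a => e (nth x0 s a.1) (nth x0 s a.2)) E ->
  hexagon_plus E -> False.
Proof.
move=> s q'y q'z yz /allP E_ok; rewrite /hexagon_plus.
have sz_s : size s = 8 by rewrite size_cat sz_q.
have s_uniq : uniq s.
  by rewrite cat_uniq q_uniq /= !inE orbF yz !andbT negb_or q'y.
have hex_ok a : a \in hexagon_edges -> e (nth x0 s a.1) (nth x0 s a.2).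
  rewrite /s; case: (q) sz_q q_cyc =>
    [|x1 [|x2 [|x3 [|x4 [|x5 [|x6 [|//]]]]]]] // _.
  case/and5P=> e1 e2 e3 e4 /and3P[e5 e6 _].
  by rewrite !inE => /or4P[|||/or3P[]] /eqP->.
have ok a : a \in hexagon_edges ++ E -> e (nth x0 s a.1) (nth x0 s a.2).
  by rewrite mem_cat => /orP[/hex_ok | /E_ok].
have k_ok i j : i < size s -> j < size s -> graph_of (hexagon_edges ++ E) i j ->
    e (nth x0 s i) (nth x0 s j).
  by move=> _ _ /orP[]/ok //=; rewrite e_sym.
rewrite -{2}sz_s => /(@has_pathP _ _ _ _ _ s_uniq k_ok 8 isT)[p [sz_p p_uniq
  p_path _]].
by have /negP := P8 sz_p p_uniq.
Qed.

Lemma mem_attached y : (y \in attached) = (y \notin q) && has (e y) q.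
Proof. by rewrite inE. Qed.

Lemma attachedP y :
  reflect (y \notin q /\ exists2 i, i < 6 & e (q_ i) y) (y \in attached).
Proof.
rewrite mem_attached; apply: (iffP andP) => -[q'y].
  case/hasP=> x qx eyx; split=> //; exists (index x q); first
    by rewrite -sz_q index_mem.
  by rewrite /q_ nth_index // e_sym.
by case=> i lt_i exy; split=> //; apply/hasP; exists (q_ i);
  rewrite ?mem_nth ?sz_q // e_sym.
Qed.

Lemma attached_atP i :
  reflect (exists2 y, y \notin q & e (q_ i) y) (attached_at i).
Proof.
apply: (iffP existsP) => [[y /andP[]] | [y q'y ey]]; exists y => //.
by rewrite q'y.
Qed.

(* Otherwise walk around the hexagon, leave it to y and go on to z. *)
Lemma attached_out y z : y \in attached -> z \notin q -> ~~ e y z.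
Proof.
case/attachedP=> q'y [i lt_i ey] q'z; apply/negP=> eyz.
have yz : y != z by apply: contraTneq eyz => ->; rewrite e_irr.
apply: (@hexagon_plusF [:: (i, 6); (6, 7)] y z) => //.
  by rewrite /= !nth_cat sz_q lt_i /= ey eyz.
have: all (fun i => hexagon_plus [:: (i, 6); (6, 7)]) (iota 0 6) by vm_compute.
by move/allP; apply; rewrite mem_iota.
Qed.

(** If one vertex serves both positions, a second attached vertex replaces it at one of them. Its
    own position is not under control, so [l] may differ from [h]. *)
Lemma distinct_representatives m h : 1 < #|attached| -> attached_at m ->
    attached_at h -> h < 6 -> h != m ->
  exists y z l, [/\ y != z, y \notin q, z \notin q &
    [/\ e (q_ m) y, e (q_ l) z, l < 6 & l != m]].
Proof.
move=> card_att /attached_atP[y q'y ey] /attached_atP[z q'z ez] lt_h hm.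
have [yz | ] := eqVneq y z; last by move=> yz; exists y, z, h.
have [w /setD1P[wy /attachedP[q'w [l lt_l ew]]]] :
    exists w, w \in attached :\ y.
  by apply/set0Pn; rewrite -card_gt0; have := cardsD1 y attached;
    clear -card_att; lia.
have [lm | lm] := eqVneq l m; last by exists y, w, l; rewrite eq_sym.
exists w, z, h; split=> //; first by rewrite -yz.
by split=> //; rewrite -lm.
Qed.

(** Two distinct vertices at consecutive positions extend the long way around the hexagon to 8
    vertices. A single vertex at both enlarges the hexagon to a 7-cycle, and another attached vertex
    then supplies the eighth. *)
Lemma attached_independent i j : 1 < #|attached| -> i < 6 -> j < 6 ->
  consecutive i j -> attached_at i -> ~~ attached_at j.
Proof.
move=> card_att lt_i lt_j cij att_i; apply/negP=> att_j.
have /attached_atP[y q'y ey] := att_i; have /attached_atP[z q'z ez] := att_j.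
have [yz | yz] := eqVneq y z; last first.
  apply: (@hexagon_plusF [:: (i, 6); (j, 7)] y z) => //.
    by rewrite /= !nth_cat sz_q lt_i lt_j /= ey ez.
  have: all (fun i => all (fun j =>
      consecutive i j ==> hexagon_plus [:: (i, 6); (j, 7)])
      (iota 0 6)) (iota 0 6) by vm_compute.
  by move/allP/(_ i); rewrite mem_iota => /(_ lt_i)/allP/(_ j);
    rewrite mem_iota cij; apply.
have [w /setD1P[wy /attachedP[q'w [l lt_l ew]]]] :
    exists w, w \in attached :\ y.
  by apply/set0Pn; rewrite -card_gt0; have := cardsD1 y attached;
    clear -card_att; lia.
apply: (@hexagon_plusF [:: (i, 6); (j, 6); (l, 7)] y w) => //.
- by rewrite eq_sym.
- by rewrite /= !nth_cat sz_q lt_i lt_j lt_l /= ey ew yz ez.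
have: all (fun i => all (fun j => consecutive i j ==>
    all (fun l => hexagon_plus [:: (i, 6); (j, 6); (l, 7)]) (iota 0 6))
    (iota 0 6)) (iota 0 6) by vm_compute.
move/allP/(_ i); rewrite mem_iota => /(_ lt_i)/allP/(_ j); rewrite mem_iota cij.
by move/(_ lt_j)/allP; apply; rewrite mem_iota.
Qed.

Lemma attached_mask : 1 < #|attached| ->
  exists2 L, L \in independent_masks &
    forall i, i < 6 -> attached_at i -> i \in L.
Proof.
move=> card_att.
have: all_bits 6 (fun b =>
    if all (fun i => all (fun j =>
      [&& consecutive i j, nth false b i & nth false b j] ==> false)
      (iota 0 6)) (iota 0 6) then
      has (fun L => all (fun i => nth false b i ==> (i \in L)) (iota 0 6))
        independent_masks
    else true) by vm_compute.
move/all_bitsP/(_ (map attached_at (iota 0 6)) (size_map _ _)).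
have nthE i : i < 6 -> nth false (map attached_at (iota 0 6)) i = attached_at i.
  by move=> lt_i; rewrite (nth_map 0) ?size_iota // nth_iota.
rewrite ifT => [/hasP[L mL /allP L_ok] | ].
  exists L => // i lt_i att_i; have := L_ok i; rewrite mem_iota => /(_ lt_i).
  by rewrite nthE // att_i.
apply/allP=> i; rewrite mem_iota => lt_i; apply/allP=> j;
  rewrite mem_iota => lt_j.
apply/implyP; rewrite !nthE // => /and3P[cij att_i].
by rewrite (negPf (attached_independent card_att lt_i lt_j cij att_i)).
Qed.

Lemma chord_free m l y z u v :
    y \notin q -> z \notin q -> y != z -> m < 6 -> l < 6 -> u < 6 -> v < 6 ->
    e (q_ m) y -> e (q_ l) z ->
  hexagon_plus [:: (m, 6); (l, 7); (u, v)] -> ~~ e (q_ u) (q_ v).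
Proof.
move=> q'y q'z yz lt_m lt_l lt_u lt_v ey ez plus; apply/negP=> euv.
apply: (@hexagon_plusF _ y z) plus => //.
by rewrite /= !nth_cat sz_q lt_m lt_l lt_u lt_v /= ey ez euv.
Qed.

Lemma count_nbrs i (l : seq nat) :
  uniq l -> all (fun j => (j < 6) && ~~ e (q_ i) (q_ j)) l ->
  count (e (q_ i)) q + size l <= 6.
Proof.
move=> l_uniq /allP l_ok.
rewrite -sz_q -(count_predC (e (q_ i)) q) leq_add2l -size_filter -(size_map q_
  l).
apply: uniq_leq_size.
  rewrite map_inj_in_uniq // => j k /l_ok/andP[lt_j _] /l_ok/andP[lt_k _] /eqP.
  by rewrite nth_uniq ?sz_q // => /eqP.
move=> _ /mapP[j /l_ok/andP[lt_j nej] ->].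
by rewrite mem_filter /= nej mem_nth ?sz_q.
Qed.

Lemma deg_hexagon i : i < 6 ->
  deg e setT (q_ i) <= count (e (q_ i)) q + attached_at i * #|attached|.
Proof.
move=> lt_i.
apply: leq_trans (_ : _ <= size ([seq x <- q | e (q_ i) x] ++
    (if attached_at i then enum attached else [::]))) _; last first.
  rewrite size_cat size_filter cardE leq_add2l.
  by case: attached_at; rewrite ?mul1n.
apply: deg_sub => y _ ey; rewrite mem_cat mem_filter ey /=.
have [// | q'y] := boolP (y \in q).
have -> : attached_at i by apply/attached_atP; exists y.
by rewrite /= mem_enum; apply/attachedP; split=> //; exists i.
Qed.

Lemma deg_attached y : y \in attached ->
  deg e setT y <= count attached_at (iota 0 6).
Proof.
move=> att_y; rewrite -size_filter -(size_map q_).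
apply: deg_sub => z _ eyz; have [qz | q'z] := boolP (z \in q); last first.
  by rewrite (negPf (attached_out att_y q'z)) in eyz.
have lt_z : index z q < 6 by rewrite -sz_q index_mem.
apply/mapP; exists (index z q); last by rewrite /q_ nth_index.
rewrite mem_filter mem_iota; apply/andP; split; last exact: lt_z.
apply/attached_atP; exists y.
  by case/attachedP: att_y.
by rewrite /q_ nth_index // e_sym.
Qed.

Definition remote : {set T} := [set y | y \notin q] :\: attached.

Lemma deg_remote w : w \in remote -> deg e setT w <= #|remote|.-1.
Proof.
move=> Ww; have -> : #|remote|.-1 = size (enum (remote :\ w)).
  by rewrite -cardE (cardsD1 w remote) Ww.
move: Ww; rewrite !inE => /andP[natt_w q'w].
apply: deg_sub => y _ ewy; rewrite mem_enum !inE.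
have q'y : y \notin q.
  apply: contra natt_w => qy.
  by rewrite q'w; apply/hasP; exists y.
rewrite q'y (contraTneq _ ewy) => [|->]; last by rewrite e_irr.
rewrite andbT; apply/negP=> /= hy.
have att_y : y \in attached by rewrite inE q'y.
by have := attached_out att_y q'w; rewrite e_sym ewy.
Qed.

Hypothesis card_T : #|T| = 14.

Lemma card_remote : #|remote| + #|attached| = 8.
Proof.
have sub : attached \subset [set y | y \notin q].
  by apply/subsetP=> y; rewrite !inE => /andP[].
have := cardsC [set y in q]; rewrite card_T.
have -> : ~: [set y in q] = [set y | y \notin q]
  by apply/setP=> y; rewrite !inE.
have -> : #|[set y in q]| = 6.
  by rewrite (card_list q_uniq) // => y; rewrite inE.
have := subset_leq_card sub.
by rewrite /remote cardsD (setIidPr sub); clear; lia.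
Qed.

(** The terms are 6 * 5 for pairs inside the hexagon, both ends of the edges between attached
    vertices and attached positions, and a complete graph on [remote]. The function [c] is a credit
    for neighbours known to be missing on the hexagon. *)
Lemma degsum_bound (c : nat -> nat) :
    (forall i, i < 6 -> count (e (q_ i)) q + c i <= 5) ->
  degsum e setT + \sum_(0 <= i < 6) c i <=
    30 + 2 * count attached_at (iota 0 6) * #|attached| +
    #|remote| * #|remote|.-1.
Proof.
move=> c_ok; set n := count _ _; set k := #|attached|.
rewrite /degsum (big_setID [set x in q]) /= setTI setTD.
rewrite [X in _ + X + _](big_setID attached) /=.
have -> : ~: [set x in q] :&: attached = attached.
  by apply/setIidPr/subsetP=> y; rewrite !inE => /andP[].
have -> : ~: [set x in q] :\: attached = remote.
  by apply/setP=> y; rewrite !inE.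
have le_att : \sum_(y in attached) deg e setT y <= k * n.
  by rewrite -sum_nat_const; apply: leq_sum => y; apply: deg_attached.
have le_rem : \sum_(y in remote) deg e setT y <= #|remote| * #|remote|.-1.
  by rewrite -sum_nat_const; apply: leq_sum => y; apply: deg_remote.
have le_hex :
    \sum_(x in [set x in q]) deg e setT x + \sum_(0 <= i < 6) c i <= 30 + n * k.
  rewrite (eq_bigl (mem q)) => [|x]; last by rewrite inE.
  rewrite -big_uniq //= (big_nth x0) sz_q -big_split /=.
  have -> : 30 + n * k = \sum_(0 <= i < 6) (5 + attached_at i * k).
    rewrite big_split /= sum_nat_const_nat -big_distrl /= /n -sum1_count.
    by rewrite big_mkcond /index_iota subn0.
  rewrite big_nat_cond [X in _ <= X]big_nat_cond; apply: leq_sum => i.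
  rewrite andbT /= => lt_i; have := c_ok i lt_i; have := deg_hexagon lt_i;
    rewrite -/k /q_; lia.
have -> : 2 * n * k = n * k + k * n by rewrite (mulnC k) -mulnA mul2n addnn.
rewrite addnAC [30 + _]addnA -[leqRHS]addnA.
exact: leq_add le_hex (leq_add le_att le_rem).
Qed.

(** Without credit the bound is at most 60, except that two positions with 3 or with 8 attached
    vertices give 62. In the case of two positions some chord of the hexagon would complete a path
    on 8 vertices; its absence saves 2. *)
Lemma few_attached : 2 < #|attached| -> count attached_at (iota 0 6) <= 2 ->
  degsum e setT <= 60.
Proof.
move=> card_att le_n2.
have arith n k r : n <= 2 -> 2 < k -> r + k = 8 ->
    30 + 2 * n * k + r * r.-1 <= 60 + (n == 2) * 2.
  move=> n_le2 k_gt2 rk; have k_le8 : k <= 8 by lia.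
  have {rk} -> : r = 8 - k by lia.
  case: n n_le2 => [|[|[|//]]] _;
    by case: k k_gt2 k_le8 => [|[|[|[|[|[|[|[|[|]]]]]]]]].
have {arith} := arith _ _ _ le_n2 card_att card_remote.
have [n2 | n_neq2] := eqVneq (count _ _) 2; last first.
  rewrite addn0; apply: leq_trans.
  have := @degsum_bound (fun=> 0); rewrite big1_eq addn0; apply=> i lt_i.
  by have := @count_nbrs i [:: i] isT;
    rewrite /= lt_i e_irr addn1 addn0 => /(_ isT).
move=> le62; have [i [j def_ij]] :
    exists i j, [seq i <- iota 0 6 | attached_at i] = [:: i; j].
  move: n2; rewrite -size_filter.
  by case: filter => [|i [|j [|//]]] // _; exists i, j.
have mem_ij l : (l \in [:: i; j]) = (l < 6) && attached_at l.
  by rewrite -def_ij mem_filter mem_iota andbC.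
have neq_ji : j != i.
  have := filter_uniq attached_at (iota_uniq 0 6).
  by rewrite def_ij /= inE andbT eq_sym.
have /andP[lt_i att_i] : (i < 6) && attached_at i by rewrite -mem_ij mem_head.
have /andP[lt_j att_j] : (j < 6) && attached_at j
  by rewrite -mem_ij !inE eqxx orbT.
have card_att1 : 1 < #|attached| by apply: ltnW.
have ncons : ~~ consecutive i j.
  by apply: contraL att_j => cij; apply: attached_independent att_i.
have [y [z [l [yz q'y q'z [ey ez lt_l li]]]]] :=
  distinct_representatives card_att1 att_i att_j lt_j neq_ji.
have lj : l = j.
  have : l \in [:: i; j].
    by rewrite mem_ij lt_l; apply/attached_atP; exists z.
  by rewrite !inE (negPf li) => /eqP.
have [u [v [lt_u lt_v uv plus]]] : exists u v, [/\ u < 6, v < 6, u != v &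
    hexagon_plus [:: (i, 6); (j, 7); (u, v)]].
  have: all (fun i => all (fun j => (j != i) && ~~ consecutive i j ==>
      has (fun u => has (fun v =>
        (u != v) && hexagon_plus [:: (i, 6); (j, 7); (u, v)])
        (iota 0 6)) (iota 0 6)) (iota 0 6)) (iota 0 6) by vm_compute.
  move/allP/(_ i); rewrite mem_iota => /(_ lt_i)/allP/(_ j); rewrite mem_iota.
  move/(_ lt_j); rewrite neq_ji ncons => /hasP[u]; rewrite mem_iota => lt_u.
  by case/hasP=> v; rewrite mem_iota => lt_v /andP[uv plus]; exists u, v.
rewrite lj in ez.
have nuv := chord_free q'y q'z yz lt_i lt_j lt_u lt_v ey ez plus.
(* The absent chord costs each of its two ends one neighbour. *)
pose c i : nat := (i == u) + (i == v).
have sum_c : \sum_(0 <= i < 6) c i = 2.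
  have sum1 a : a < 6 -> \sum_(0 <= i < 6) (i == a) = 1.
    by case: a => [|[|[|[|[|[|]]]]]] // _; rewrite unlock.
  by rewrite big_split /= !sum1.
rewrite -(leq_add2r 2) -{1}sum_c; apply: leq_trans le62.
apply: degsum_bound => a lt_a; rewrite /c.
have [-> | au] := eqVneq a u.
  have := @count_nbrs u [:: u; v];
    rewrite /= !inE lt_u lt_v e_irr nuv uv (negPf uv) => /(_ isT isT).
  clear; lia.
have [-> | av] := eqVneq a v.
  have := @count_nbrs v [:: v; u];
    rewrite /= !inE lt_u lt_v e_irr e_sym nuv eq_sym uv => /(_ isT isT).
  clear; lia.
have := @count_nbrs a [:: a] isT; rewrite /= lt_a e_irr => /(_ isT); clear; lia.
Qed.

(** By [few_attached] at least three positions are attached, so they are exactly an alternating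
    triple, the hubs; [W] is [remote]. An edge between two non-hubs outside [W] is a chord of the
    hexagon, an edge at an attached vertex, or a new attachment, and each is impossible. *)
Lemma hubs_exist : 2 < #|attached| -> 60 < degsum e setT ->
  exists H W : {set T}, [/\ #|H| = 3, #|W| <= 5, [disjoint H & W],
    {in ~: (H :|: W) & ~: H, forall x y, ~~ e x y} &
    {in W & H, forall x y, ~~ e x y}].
Proof.
move=> card_att big_deg; have card_att1 : 1 < #|attached| by apply: ltnW.
have card_N : 2 < count attached_at (iota 0 6).
  by rewrite ltnNge; apply: contraL big_deg => /(few_attached card_att);
    rewrite leqNgt.
have [L mL att_L] := attached_mask card_att1.
have sz_L : size L <= 3 by move: mL; rewrite !inE => /or4P[|||/orP[]] /eqP->.
have L_uniq : uniq L by move: mL; rewrite !inE => /or4P[|||/orP[]] /eqP->.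
have L_lt6 i : i \in L -> i < 6.
  have: all (all (fun i => i < 6)) independent_masks by [].
  by move/allP/(_ L mL)/allP; apply.
have att_eq i : i \in L -> attached_at i.
  have sub : {subset [seq i <- iota 0 6 | attached_at i] <= L}.
    by move=> j; rewrite mem_filter mem_iota => /andP[att_j lt_j]; apply: att_L.
  have [|_ eq_L] := uniq_min_size (filter_uniq _ (iota_uniq 0 6)) sub.
    by rewrite size_filter; apply: leq_trans sz_L card_N.
  by rewrite -eq_L mem_filter => /andP[].
have sz_L3 : size L = 3.
  apply/eqP; rewrite eqn_leq sz_L /=; apply: leq_trans card_N _.
  rewrite -size_filter; apply: uniq_leq_size; first
    by rewrite filter_uniq ?iota_uniq.
  by move=> j; rewrite mem_filter mem_iota => /andP[att_j lt_j]; apply: att_L.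
pose H := [set x in map q_ L]; exists H, remote.
have mem_H x : reflect (exists2 i, i \in L & x = q_ i) (x \in H).
  by rewrite inE; apply: mapP.
have H_q x : x \in H -> x \in q.
  by case/mem_H=> i /L_lt6 lt_i ->; rewrite mem_nth ?sz_q.
have pos x : x \in q -> exists2 i, i < 6 & x = q_ i.
  by move=> qx; exists (index x q); rewrite ?/q_ ?nth_index // -sz_q index_mem.
split.
- rewrite (@card_list _ H (map q_ L)) ?size_map // => [|x]; last by rewrite inE.
  rewrite map_inj_in_uniq // => i j /L_lt6 lt_i /L_lt6 lt_j /eqP.
  by rewrite nth_uniq ?sz_q // => /eqP.
- by have := card_remote; clear -card_att; lia.
- rewrite disjoint_subset; apply/subsetP=> x /H_q qx.
  by rewrite !inE qx andbF.
- move=> x y; rewrite !in_setC in_setU negb_or => /andP[H'x W'x] H'y.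
  have [qx | q'x] := boolP (x \in q); last first.
    have att_x : x \in attached.
      by apply: contraR W'x => natt_x; rewrite in_setD natt_x inE.
    have [qy | q'y] := boolP (y \in q); last exact: attached_out.
    apply: contra H'y => exy; have [i lt_i def_y] := pos y qy.
    apply/mem_H; exists i => //; apply: att_L => //.
    by apply/attached_atP; exists x; rewrite // -/q_ -def_y e_sym.
  have [u lt_u def_x] := pos x qx.
  have Lu : u \notin L by apply: contra H'x => Lu; apply/mem_H; exists u.
  have [qy | q'y] := boolP (y \in q); last first.
    apply: contra Lu => exy; apply: att_L => //; apply/attached_atP.
    by exists y; rewrite // -/q_ -def_x.
  have [v lt_v def_y] := pos y qy.
  have Lv : v \notin L by apply: contra H'y => Lv; apply/mem_H; exists v.
  have [uv | uv] := eqVneq u v; first by rewrite def_x def_y uv e_irr.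
  (* The suitable [m] is the hub between [u] and [v]: with the chord, a path through the whole
     hexagon leads from it to either other hub. All [l] must be covered because
     [distinct_representatives] does not let [l] be chosen. *)
  have: all (fun L => (size L == 3) ==> all (fun u => all (fun v =>
      [&& u \notin L, v \notin L & u != v] ==>
      has (fun m => has (predC1 m) L && all (fun l =>
        (l != m) ==> hexagon_plus [:: (m, 6); (l, 7); (u, v)]) L) L)
      (iota 0 6)) (iota 0 6)) independent_masks by vm_compute.
  move/allP/(_ L mL); rewrite sz_L3 => /allP/(_ u);
    rewrite mem_iota => /(_ lt_u).
  move/allP/(_ v); rewrite mem_iota => /(_ lt_v); rewrite Lu Lv uv.
  case/hasP=> m Lm /andP[/hasP[h Lh /= hm] /allP plus].
  have [a [b [l [ab q'a q'b [ea eb lt_l lm]]]]] :=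
    distinct_representatives card_att1 (att_eq m Lm) (att_eq h Lh) (L_lt6 h Lh)
      hm.
  have Ll : l \in L by apply: att_L => //; apply/attached_atP; exists b.
  rewrite def_x def_y; apply: chord_free q'a q'b ab (L_lt6 m Lm) lt_l lt_u lt_v
    ea eb _.
  by have := plus l Ll; rewrite lm.
move=> x y; rewrite !inE => /andP[natt_x q'x] /mapP[i Li def_y].
apply: contra natt_x => exy; rewrite q'x; apply/hasP; exists y => //.
by rewrite def_y mem_nth ?sz_q ?L_lt6.
Qed.

End Hexagon.

(** * Three hubs *)

(* Labels: 0-5 the hexagon, whose vertices in W are marked in w; 6-10 the other
   non-hubs, namely a vertex that lies in W iff y, then nw vertices of W, then
   vertices outside W; 11-13 the hubs.  Label 6 is attached to the hexagon if
   one of 6-10 is; the case that none is has its own avoids_hexagon_color0. *)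
Definition in_W (w : bitseq) (y : bool) (nw i : nat) : bool :=
  if i < 6 then nth false w i else if i == 6 then y else i < 7 + nw.

Definition symm (k : rel nat) : rel nat := fun i j => k i j || k j i.

(** Left open are pairs inside W, pairs of hubs, and pairs of a hub with a non-hub outside W: these
    may have the first colour. *)
Definition avoids_hub_color (w : bitseq) (y : bool) (nw : nat) : rel nat :=
  symm (fun i j => [&& i < 11, j < 11 & ~~ in_W w y nw i] ||
                   [&& i < 11, 11 <= j & in_W w y nw i]).

(** Positions outside [L] send no second-colour edge off the hexagon, and the attached label 6 sends
    none to other vertices off the hexagon, by [attached_out]. *)
Definition avoids_hexagon_color (L : seq nat) : rel nat :=
  symm (fun i j => [&& i < 6, 6 <= j & i \notin L] || (i == 6) && (7 <= j)).

(** The hubs 11-13 are excluded because they may still be attached to the second hexagon. *)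
Definition avoids_hexagon_color0 : rel nat :=
  symm (fun i j => (i < 6) && (6 <= j < 11)).

Definition third_color_path
    (w : bitseq) (y : bool) (nw : nat) (k : rel nat) : bool :=
  has_path 8 14 (fun i j => [&& i != j, avoids_hub_color w y nw i j & k i j]).

Definition hub_check : bool :=
  all_bits 6 (fun w => all (fun y : bool => all (fun nw =>
    if count id w + y + nw <= 5 then
      third_color_path w y nw avoids_hexagon_color0 &&
      all (fun L => third_color_path w y nw (avoids_hexagon_color L))
        independent_masks
    else true) (iota 0 5)) [:: true; false]).

Lemma hub_checkP w (y : bool) nw :
    size w = 6 -> nw < 5 -> count id w + y + nw <= 5 ->
  third_color_path w y nw avoids_hexagon_color0 /\
  {in independent_masks, forall L,
    third_color_path w y nw (avoids_hexagon_color L)}.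
Proof.
have: hub_check by vm_compute.
move=> /all_bitsP check sz_w lt_nw le5; have {check} := check w sz_w.
have y_bool : y \in [:: true; false] by case: y {le5}.
move/allP/(_ y y_bool)/allP/(_ nw);
  rewrite mem_iota le5 => /(_ lt_nw)/andP[? /allP ?].
by split.
Qed.

Section Hubs.

Variables (T : finType) (col : T -> T -> 'I_3).
Hypothesis col_sym : forall x y, col x y = col y x.
Hypothesis no_path8 : forall c, path8_free (in_color col c).
Hypothesis card_T : #|T| = 14.
Variable x0 : T.

Let in_color_sym := in_color_sym col_sym.
Let in_color_irr := in_color_irr col.

Lemma hexagon_attached c q : size q = 6 -> uniq q -> cycle (in_color col c) q ->
  2 < #|attached (in_color col c) q|.
Proof.
move=> sz_q q_uniq q_cyc; rewrite ltnNge; apply/negP=> card_att.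
have card_rem := card_remote (in_color col c) sz_q q_uniq card_T.
have no_c :
    {in remote (in_color col c) q & ~: remote (in_color col c) q, forall x y,
      col x y != c}.
  move=> x y; rewrite !inE => /andP[natt_x q'x]; rewrite negb_and !negbK => Cy.
  have xy : x != y.
    by apply: contraTneq Cy => <-; rewrite negb_or natt_x.
  apply: contraNneq natt_x => cxy; rewrite q'x.
  have in_xy : in_color col c x y by rewrite /in_color xy cxy eqxx.
  have [qy | q'y] := boolP (y \in q); first by apply/hasP; exists y.
  case/orP: Cy => [Cy | qy]; last by rewrite qy in q'y.
  have att_y : y \in attached (in_color col c) q by rewrite inE.
  have := attached_out (in_color_sym c) (in_color_irr c) (@no_path8 c) x0
    sz_q q_uniq q_cyc att_y q'x.
  by rewrite in_color_sym in_xy.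
have [card6 | rem8] := boolP (#|remote (in_color col c) q| < 8).
  apply: (no_split col_sym no_path8 card_T _ no_c);
    clear -card_att card_rem card6; lia.
(* All 8 outside vertices are remote here, so the complement, of size 6, serves as the small
   side. *)
apply: (@no_split T col col_sym no_path8 card_T c (~: remote (in_color col c)
  q)).
  by have := cardsC (remote (in_color col c) q); rewrite card_T;
    clear -card_att card_rem rem8; lia.
by move=> x y; rewrite setCK col_sym => Cx Ry; apply: no_c.
Qed.

Lemma sum_degsum (S : {set T}) :
  \sum_c degsum (in_color col c) S = #|S| * #|S|.-1.
Proof.
rewrite exchange_big /= -sum_nat_const; apply: eq_bigr => x Sx.
rewrite exchange_big /= (cardsD1 x S) Sx /= -sum1_card (big_setD1 x) //=.
rewrite big1 => [|c _]; last by rewrite in_color_irr.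
rewrite add0n; apply: eq_bigr => y /setD1P[yx _].
by rewrite sum_in_color // eq_sym.
Qed.

(** A pair that avoids both the hub colour and the colour of the second hexagon has the third
    colour. [hub_check] shows that, wherever W lies relative to the hexagon, such pairs contain a
    path on 8 vertices. *)
Lemma no_hubs r (H W : {set T}) : #|H| = 3 -> #|W| <= 5 -> [disjoint H & W] ->
    {in ~: (H :|: W) & ~: H, forall x y, ~~ in_color col r x y} ->
    {in W & H, forall x y, ~~ in_color col r x y} -> False.
Proof.
move=> card_H card_W HW no_r1 no_r2.
have W_H x : x \in W -> x \notin H.
  by apply: contraL => Hx; rewrite (disjointFr HW Hx).
have card_Z : #|~: H| = 11
  by have := cardsC H; rewrite card_T; clear -card_H; lia.
have sum_Z : \sum_c degsum (in_color col c) (~: H) = 110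
  by rewrite sum_degsum card_Z.
have red_Z : degsum (in_color col r) (~: H) <= 20.
  have sWZ : W \subset ~: H by apply/subsetP=> x; rewrite inE; apply: W_H.
  rewrite /degsum (big_setID W) /= (setIidPr sWZ) [X in _ + X]big1 => [|x].
    rewrite addn0; apply: (@leq_trans (\sum_(x in W) 4)).
      apply: leq_sum => x Wx; apply: (@leq_trans (size (enum (W :\ x)))).
        apply: deg_sub => y; rewrite inE => H'y cxy; rewrite mem_enum !inE.
        rewrite (contraTneq _ cxy) => [|->]; last by rewrite in_color_irr.
        apply: contraLR cxy => W'y; rewrite in_color_sym; apply: no_r1.
          by rewrite !inE negb_or H'y.
        by rewrite inE W_H.
      by rewrite -cardE; have := cardsD1 x W; rewrite Wx; clear -card_W; lia.
    by rewrite sum_nat_const; clear -card_W; lia.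
  rewrite !inE => /andP[W'x H'x]; rewrite /deg big1 // => y Zy.
  by apply/eqP; rewrite eqb0; apply: no_r1; rewrite // !inE negb_or H'x.
(* Of the degree sum 110, colour [r] takes at most 5 * 4 = 20, so another colour has at least 45,
   above the bound 44 = 4 * 11 of [degsum_le]. *)
have [b br deg_b] : exists2 b, b != r & 44 < degsum (in_color col b) (~: H).
  have [/exists_inP // | ] :=
    boolP [exists (b | b != r), 44 < degsum (in_color col b) (~: H)].
  rewrite negb_exists_in => /forall_inP le_deg.
  have : \sum_(c | c != r) degsum (in_color col c) (~: H)
      <= \sum_(c in predC1 r) 44.
    by apply: leq_sum => c /le_deg; rewrite -leqNgt.
  rewrite sum_nat_const cardC1 card_ord.
  by move: sum_Z; rewrite (bigD1 r) //=; clear -red_Z; lia.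
have [g def_g] := third_color br.
have [no6 | [q [sz_q q_uniq q_Z q_cyc]]] := no_cycleP (in_color col b) (~: H) 6.
  by have := degsum_le (in_color_sym b) (in_color_irr b) (no_path8 b) no6;
    rewrite card_Z; clear -deg_b; lia.
have card_att : 1 < #|attached (in_color col b) q|
  by apply/ltnW/hexagon_attached.
have [L mL att_L] := attached_mask (in_color_sym b)
  (@no_path8 b) x0 sz_q q_uniq q_cyc card_att.
pose D := ~: H :\: [set x in q].
have card_D : #|D| = 5.
  have sub : [set x in q] \subset ~: H
    by apply/subsetP=> x; rewrite inE; apply: q_Z.
  rewrite cardsD (setIidPr sub) card_Z (@card_list _ [set x in q] q) ?sz_q //.
  by move=> x; rewrite inE.
(* The vertex [y] receives label 6. It is attached whenever some vertex of [D] is, so if it is not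
   attached, [avoids_hexagon_color0] describes all of [D]. *)
have [y Dy y_att] : exists2 y, y \in D &
    y \notin attached (in_color col b) q ->
    {in D, forall z, z \notin attached (in_color col b) q}.
  have [/exists_inP[y Dy att_y] | ] :=
    boolP [exists (y | y \in D), y \in attached (in_color col b) q].
    by exists y => //; rewrite att_y.
  rewrite negb_exists_in => /forall_inP natt.
  have [y Dy] : exists y, y \in D by apply/set0Pn; rewrite -card_gt0 card_D.
  by exists y.
pose dW := enum ((D :\ y) :&: W); pose dI := enum ((D :\ y) :\: W).
pose s := q ++ y :: dW ++ dI ++ enum H.
have sz_d : size dW + size dI = 4.
  by rewrite -!cardE cardsID; have := cardsD1 y D; rewrite Dy card_D => -[].
have sz_H : size (enum H) = 3 by rewrite -cardE.
have sz_s : size s = 14 by rewrite !size_cat /= !size_cat sz_q sz_H;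
  clear -sz_d; lia.
have s_uniq : uniq s.
  apply/card_uniqP; rewrite sz_s -card_T; apply: eq_card => x.
  rewrite !mem_cat inE !mem_cat !mem_enum !inE.
  by case: (x \in H) (x \in q) (x == y) (x \in W) => [] [] [] [].
pose w := map (mem W) q; pose nw := size dW.
have sz_I : size dI = 4 - nw by rewrite -sz_d addKn.
have le5 : count id w + (y \in W) + nw <= 5.
  have dW_W : all (mem W) dW by apply/allP=> x; rewrite mem_enum => /setIP[].
  have t_uniq : uniq [seq x <- q ++ y :: dW | x \in W].
    rewrite filter_uniq //; apply: subseq_uniq s_uniq.
    have -> : s = (q ++ y :: dW) ++ (dI ++ enum H) by rewrite -catA.
    exact: prefix_subseq.
  apply: leq_trans card_W; rewrite cardE;
    apply: leq_trans (uniq_leq_size t_uniq _).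
    rewrite filter_cat size_cat /= (all_filterP dW_W) count_map size_filter
      -addnA.
    by rewrite leq_add2l; case: (y \in W).
  by move=> x; rewrite mem_filter mem_enum => /andP[].
have [||path0 pathL] := @hub_checkP w (y \in W) nw _ _ le5.
- by rewrite size_map.
- by rewrite /nw; clear -sz_d; lia.
pose f := nth x0 s.
have f_q i : i < 6 -> f i = nth x0 q i
  by move=> lt_i; rewrite /f nth_cat sz_q lt_i.
have f_out i : 6 <= i -> f i = nth x0 ((y :: dW ++ dI) ++ enum H) (i - 6).
  by move=> le_i; rewrite /f /s (nth_cat x0 q) sz_q ltnNge le_i /= catA.
have f_in i : 6 <= i < 11 -> f i = nth x0 (y :: dW ++ dI) (i - 6).
  move=> /andP[le_i lt_i]; rewrite f_out // nth_cat ifT //= size_cat;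
    clear -sz_d le_i lt_i; lia.
have f_D i : 6 <= i < 11 -> f i \in D.
  move=> i_range; rewrite f_in //.
  have : nth x0 (y :: dW ++ dI) (i - 6) \in y :: dW ++ dI.
    by rewrite mem_nth //= size_cat; clear -sz_d i_range; lia.
  rewrite inE mem_cat !mem_enum =>
    /predU1P[-> // | /orP[/setIP[/setD1P[]] // |]].
  by case/setDP=> /setD1P[].
have f_H i : 11 <= i < 14 -> f i \in H.
  move=> /andP[le_i lt_i]; rewrite f_out ?(leq_trans _ le_i) //
    nth_cat /= size_cat sz_d.
  rewrite ifN; last by rewrite -leqNgt; clear -le_i; lia.
  by rewrite -mem_enum mem_nth // sz_H; clear -le_i lt_i; lia.
have f_W i : i < 11 -> (f i \in W) = in_W w (y \in W) nw i.
  rewrite /in_W => lt_i; case: ltnP => [lt6 | le6].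
    by rewrite f_q // (nth_map x0) ?sz_q.
  rewrite f_in ?le6 //; have [-> // | i6] := eqVneq i 6.
  have -> : i - 6 = (i - 7).+1 by clear -le6 i6; lia.
  rewrite /= nth_cat; have -> : (i < 7 + nw) = (i - 7 < nw)
    by clear -le6 i6; lia.
  rewrite -/nw; case: ltnP => [lt_nw | le_nw].
    have : nth x0 dW (i - 7) \in dW by apply: mem_nth.
    by rewrite mem_enum => /setIP[].
  have : nth x0 dI (i - 7 - nw) \in dI
    by apply: mem_nth; rewrite sz_I; clear -lt_i le6 i6 le_nw; lia.
  by rewrite mem_enum => /setDP[_ /negPf].
have f_Z i : i < 11 -> f i \notin H.
  move=> lt_i; have [lt6 | le6] := ltnP i 6.
    by have := q_Z (f i); rewrite inE; apply; rewrite f_q // mem_nth ?sz_q.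
  by have := f_D i; rewrite le6 lt_i !inE => /(_ isT)/andP[].
have f_q' i : 6 <= i < 14 -> f i \notin q.
  move=> /andP[le_i lt_i]; have [lt11 | le11] := ltnP i 11.
    by have := f_D i; rewrite le_i lt11 !inE => /(_ isT)/andP[].
  by apply: contraL (f_H i _) => [/q_Z|]; rewrite ?inE // le11.
have not_r i j : i < 14 -> j < 14 -> avoids_hub_color w (y \in W) nw i j ->
    ~~ in_color col r (f i) (f j).
  wlog ij : i j / ([&& i < 11, j < 11 & ~~ in_W w (y \in W) nw i] ||
                   [&& i < 11, 11 <= j & in_W w (y \in W) nw i])
    => [IH lt_i lt_j | lt_i lt_j _].
    case/orP=> ij; first by apply: IH => //; rewrite /avoids_hub_color /symm ij.
    by rewrite in_color_sym; apply: IH => //;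
      rewrite /avoids_hub_color /symm ij.
  case/orP: ij => /and3P[lt11 j11]; rewrite -f_W // => Wi.
    by apply: no_r1; rewrite !inE ?negb_or ?f_Z.
  by apply: no_r2; rewrite ?f_H // j11.
have third (k : rel nat) :
    (forall i j, i < 14 -> j < 14 -> k i j -> ~~ in_color col b (f i) (f j)) ->
    third_color_path w (y \in W) nw k -> False.
  move=> not_b; rewrite /third_color_path -sz_s => path_k.
  have [|p [sz_p p_uniq p_path _]]
    := @has_pathP _ (in_color col g) x0 s _ s_uniq _ 8 isT path_k.
    move=> i j; rewrite sz_s => lt_i lt_j /and3P[ij /not_r nr /not_b nb].
    have fij : f i != f j by rewrite nth_uniq ?sz_s.
    move: (nr lt_i lt_j) (nb lt_i lt_j); rewrite /in_color fij /= => ncr ncb.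
    by apply/eqP; apply: def_g.
  by have /negP := @no_path8 g p sz_p p_uniq.
have [att_y | natt_y] := boolP (y \in attached (in_color col b) q).
  apply: third (pathL L mL) => i j lt_i lt_j.
  wlog ij : i j lt_i lt_j /
      [&& i < 6, 6 <= j & i \notin L] || (i == 6) && (7 <= j).
    move=> IH /orP[] ij; first
      by apply: IH => //; rewrite /avoids_hexagon_color /symm ij.
    by rewrite in_color_sym; apply: IH => //;
      rewrite /avoids_hexagon_color /symm ij.
  move=> _; case/orP: ij => [/and3P[lt6 le6 L'i] | /andP[/eqP-> le7]].
    apply: contra L'i => bij; apply: att_L => //; apply/attached_atP.
    by exists (f j); rewrite -?f_q // f_q' ?le6.
  apply: (attached_out (in_color_sym b) (in_color_irr b) (@no_path8 b) x0 sz_q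
    q_uniq q_cyc).
    by rewrite f_in.
  by rewrite f_q' // (leq_trans _ le7).
apply: third path0 => i j lt_i lt_j.
wlog ij : i j lt_i lt_j / (i < 6) && (6 <= j < 11).
  move=> IH /orP[] ij; first
    by apply: IH => //; rewrite /avoids_hexagon_color0 /symm ij.
  by rewrite in_color_sym; apply: IH => //;
    rewrite /avoids_hexagon_color0 /symm ij.
case/andP: ij => lt6 j_range _; apply: contraL (f_D j j_range) => bij.
apply/negP=> Dj; have /negP := y_att natt_y (f j) Dj; apply; rewrite inE.
rewrite f_q' /=; last by case/andP: j_range => ->.
apply/hasP; exists (f i); last by rewrite in_color_sym.
by rewrite f_q // mem_nth ?sz_q.
Qed.

End Hubs.

(** * The Ramsey number *)

Lemma not_all_path8_free (T : finType) (col : T -> T -> 'I_3) :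
  (forall x y, col x y = col y x) -> #|T| = 14 ->
  ~ (forall c, path8_free (in_color col c)).
Proof.
move=> col_sym card_T no_path8.
have /card_gt0P[x0 _] : 0 < #|T| by rewrite card_T.
have sum_deg : \sum_c degsum (in_color col c) setT = 182.
  by rewrite sum_degsum cardsT card_T.
have [r deg_r] : exists r, 60 < degsum (in_color col r) setT.
  have [/existsP // | ] := boolP [exists r, 60 < degsum (in_color col r) setT].
  rewrite negb_exists => /forallP le_deg.
  have : \sum_c degsum (in_color col c) setT <= \sum_(c : 'I_3) 60.
    by apply: leq_sum => c _; rewrite leqNgt.
  by rewrite sum_deg sum_nat_const card_ord.
have [no6 | [q [sz_q q_uniq _ q_cyc]]] := no_cycleP (in_color col r) setT 6.
  have := degsum_le (in_color_sym col_sym r) (in_color_irr col r) (@no_path8 r)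
    no6.
  by rewrite cardsT card_T leqNgt (leq_trans _ deg_r).
have card_att := hexagon_attached col_sym no_path8 card_T x0 sz_q q_uniq q_cyc.
have [H [W [card_H card_W HW no_r1 no_r2]]]
  := hubs_exist (in_color_sym col_sym r)
  (in_color_irr col r) (@no_path8 r) x0 sz_q q_uniq q_cyc card_T card_att deg_r.
exact: (no_hubs col_sym no_path8 card_T x0 card_H card_W HW no_r1 no_r2).
Qed.

Lemma ramsey_14 : ramsey_property 3 (path_graph 8) 14.
Proof.
move=> c; pose col (x y : 'I_14) := c [set x; y].
have col_sym x y : col x y = col y x by rewrite /col setUC.
have [/existsP[i /existsP[s /andP[s_uniq s_path]]] | no_path] :=
    boolP [exists i, [exists s : 8.-tuple 'I_14,
             uniq s && sorted (in_color col i) s]].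
  exists i; exists (fun k : 'I_8 => tnth s k) => [j k | j k].
    by move/tuple_uniqP: s_uniq; apply.
  have step (a b : 'I_8) : a.+1 = b -> in_color col i (tnth s a) (tnth s b).
    move=> ab; have lt_a : a.+1 < size s by rewrite size_tuple ab.
    have /(sortedP ord0)/(_ a lt_a) := s_path.
    by rewrite !(tnth_nth ord0) -ab.
  case/orP=> /eqP; first exact: step.
  by move/step; rewrite in_color_sym.
case: (not_all_path8_free col_sym (card_ord 14)) => i s /eqP sz_s s_uniq.
apply: contra no_path => s_path; apply/existsP; exists i.
by apply/existsP; exists (Tuple sz_s); rewrite s_uniq.
Qed.

(* Sort the vertices by x %% 4 into classes of at most 4, 3, 3 and 3 vertices,
   indexed by (Z/2)^2; colour i joins classes that agree under the i-th of
   the three nonzero linear forms, so its components have at most 7 vertices. *)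
Definition form (i x : nat) : bool :=
  nth false [:: 1 < x %% 4; odd x; odd x (+) (1 < x %% 4)] i.

Definition form_constant M (i : nat) (S : {set 'I_M}) : bool :=
  [forall x in S, forall y in S, form i x == form i y].

Definition form_coloring M : edge_coloring (complete_graph M) 3 := fun S =>
  if form_constant 0 S then ord0
  else if form_constant 1 S then inord 1 else inord 2.

Lemma form_constant2 M i (x y : 'I_M) :
  form_constant i [set x; y] = (form i x == form i y).
Proof.
apply/forall_inP/eqP => [const | eq_xy z].
  by have /forall_inP/(_ y (set22 x y))/eqP := const x (set21 x y).
by rewrite !inE => z_xy; apply/forall_inP=> t; rewrite !inE => t_xy;
  case/orP: z_xy => /eqP->; case/orP: t_xy => /eqP->; rewrite ?eq_xy.
Qed.

(** A pair of colour 2 disagrees under forms 0 and 1, hence agrees under form 2, their sum modulo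
    2. *)
Lemma form_coloringP M (x y : 'I_M) (i : 'I_3) :
  form_coloring [set x; y] = i -> form i x = form i y.
Proof.
rewrite /form_coloring !form_constant2.
have [eq0 <- // | neq0] := eqVneq (form 0 x) (form 0 y).
have [eq1 <- | neq1 <-] := eqVneq (form 1 x) (form 1 y); rewrite inordK //.
move: neq0 neq1; rewrite /form /=.
by case: (odd x) (1 < x %% 4) (odd y) (1 < y %% 4) => [] [] [] [].
Qed.

(** A value of a form selects two residues modulo 4; among 0, ..., 12 they occur at most 4 + 3
    times. *)
Lemma form_class_small (i : 'I_3) b M : M <= 13 ->
  count (fun x => form i x == b) (iota 0 M) <= 7.
Proof.
move=> le_M; apply: (@leq_trans (count (fun x => form i x == b) (iota 0 13))).
  by rewrite -(subnKC le_M) iotaD count_cat leq_addr.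
by case: i => [[|[|[|]]]] //= _; case: b.
Qed.

(** Form [i] is constant along a path of colour [i], so 8 distinct vertices would share a class of
    at most 7. *)
Lemma ramsey_lower M : ramsey_property 3 (path_graph 8) M -> 14 <= M.
Proof.
move=> /(_ (form_coloring (M := M)))[i [f f_inj f_adj]].
rewrite leqNgt; apply/negP; rewrite ltnS => le_M.
have form_f (k : 'I_8) : form i (f k) = form i (f ord0).
  case: k => k; elim: k => [|k IHk] lt_k; first
    by congr (form i (f _)); apply: val_inj.
  rewrite -(IHk (ltnW lt_k)); apply: form_coloringP.
  have := f_adj (Ordinal lt_k) (Ordinal (ltnW lt_k)).
  by rewrite /= /path_adj eqxx orbT => /(_ isT)/andP[_ /eqP].
have := form_class_small i (form i (f ord0)) le_M; apply/negP; rewrite -ltnNge.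
have f_uniq : uniq [seq val (f k) | k <- enum 'I_8].
  by rewrite map_inj_uniq ?enum_uniq // => j k /val_inj/f_inj.
have := uniq_leq_size f_uniq; rewrite size_map size_enum_ord -size_filter;
  apply.
move=> _ /mapP[k _ ->].
by rewrite mem_filter form_f eqxx mem_iota ltn_ord.
Qed.

Theorem theorem10 : is_ramsey_number 3 (path_graph 8) 14.
Proof. by split; [exact: ramsey_14 | exact: ramsey_lower]. Qed.
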